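(* For all $a,b,c\ge 0$, the minimal $Q$-free resolution of $Q/I_{L(a,b,c)}$ admits the structure of a differential graded algebra.
   Context: $L(a,b,c)$ is the graph with vertex set $\{x,y\}\cup\{x_i\}_{i=1}^a\cup\{y_j\}_{j=1}^b\cup\{z_k\}_{k=1}^c$ and edges $\{x,y\}$, $\{x,x_i\}$, $\{y,y_j\}$, $\{x,z_k\},\{y,z_k\}$; $Q$ is the polynomial ring over a field $\Bbbk$ in these vertices, and $I_{L(a,b,c)}$ is its edge ideal. (These are exactly the graphs whose edge ideals have a minimal Lyubeznik resolution.) A differential graded (dg) algebra structure on a complex of free $Q$-modules is a unital associative multiplication satisfying $\mathcal{A}_i\mathcal{A}_j\subseteq\mathcal{A}_{i+j}$, $ab=(-1)^{|a||b|}ba$, $a^2=0$ for $|a|$ odd, and the Leibniz rule $\partial(ab)=\partial(a)b+(-1)^{|a|}a\partial(b)$. *)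

(* Defs.v *)
From HB Require Import structures.
From mathcomp Require Import all_boot all_order all_algebra.
From mathcomp Require Import mpoly.
Set Implicit Arguments. Unset Strict Implicit. Unset Printing Implicit Defensive.
Import GRing.Theory.
Local Open Scope ring_scope.

(* The graph L(a,b,c).  Vertices are 'I_(a+b+c+2), numbered as        *)
(*   x = 0, y = 1, x_i = 2 + (i-1) (1<=i<=a),                          *)
(*   y_j = 2 + a + (j-1) (1<=j<=b), z_k = 2 + a + b + (k-1) (1<=k<=c). *)
Definition L_isX (a b c : nat) (w : nat) : bool := (2 <= w < 2 + a)%N.
Definition L_isY (a b c : nat) (w : nat) : bool := (2 + a <= w < 2 + a + b)%N.
Definition L_isZ (a b c : nat) (w : nat) : bool := (2 + a + b <= w < 2 + a + b + c)%N.

Definition L_arc (a b c : nat) (u v : nat) : bool :=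
  [|| (u == 0%N) && (v == 1%N),
      (u == 0%N) && L_isX a b c v,
      (u == 1%N) && L_isY a b c v,
      (u == 0%N) && L_isZ a b c v
    | (u == 1%N) && L_isZ a b c v].

Definition L_edge (a b c : nat) : rel 'I_(a + b + c + 2) :=
  fun u v => L_arc a b c u v || L_arc a b c v u.

Arguments L_edge : clear implicits.

Definition edge_ideal (k : fieldType) (n : nat) (E : rel 'I_n)
    (p : {mpoly k[n]}) : Prop :=
  exists f : 'I_n -> 'I_n -> {mpoly k[n]},
    p = \sum_(u : 'I_n) \sum_(v : 'I_n | E u v) f u v * ('X_u * 'X_v).

(* Complexes of finitely generated free Q-modules, encoded as a single *)
(* free module Q^N = (+)_i F_i with a homological degree attached to    *)
(* each basis vector; elements are row vectors, the differential acts  *)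
(* by right multiplication v |-> v *m D.                               *)
Section Complexes.
Variables (Q : comNzRingType) (N : nat) (deg : 'I_N -> nat).

Definition inF (i : nat) (v : 'rV[Q]_N) : Prop :=
  forall p : 'I_N, v 0 p != 0 -> deg p = i.

Definition is_complex (D : 'M[Q]_N) : Prop :=
  (forall p q : 'I_N, D p q != 0 -> deg p = (deg q).+1) /\ D *m D = 0.

Definition is_free_resolution (I : Q -> Prop) (D : 'M[Q]_N) : Prop :=
  [/\ is_complex D,
      #|[pred p | deg p == 0%N]| = 1%N,
      (forall (i : nat) (v : 'rV[Q]_N), inF i.+1 v -> v *m D = 0 ->
          exists2 w : 'rV[Q]_N, inF i.+2 w & v = w *m D) &
      (forall v : 'rV[Q]_N, inF 0 v ->
          ((exists2 w : 'rV[Q]_N, inF 1 w & v = w *m D) <->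
           (forall p : 'I_N, deg p = 0%N -> I (v 0 p))))].

Definition is_dga (D : 'M[Q]_N) (mul : 'rV[Q]_N -> 'rV[Q]_N -> 'rV[Q]_N)
  : Prop :=
  [/\ (forall (r : Q) (u v w : 'rV[Q]_N),
          mul (r *: u + v) w = r *: mul u w + mul v w),
      (forall (r : Q) (u v w : 'rV[Q]_N),
          mul w (r *: u + v) = r *: mul w u + mul w v),
      (exists e : 'rV[Q]_N, forall v, mul e v = v /\ mul v e = v) &
      (forall u v w, mul (mul u v) w = mul u (mul v w))] /\
  [/\ (forall (i j : nat) (u v : 'rV[Q]_N), inF i u -> inF j v ->
          inF (i + j) (mul u v)),
      (forall (i j : nat) (u v : 'rV[Q]_N), inF i u -> inF j v ->
          mul u v = (-1) ^+ (i * j) *: mul v u),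
      (forall (i : nat) (u : 'rV[Q]_N), odd i -> inF i u -> mul u u = 0) &
      (forall (i : nat) (u v : 'rV[Q]_N), inF i u ->
          (mul u v) *m D = mul (u *m D) v + (-1) ^+ i *: mul u (v *m D))].

End Complexes.

(* minimality: all entries of the differential lie in the maximal      *)
(* ideal (x_v : v) of the polynomial ring, i.e. have zero constant term *)
Definition is_minimal (k : fieldType) (n N : nat) (D : 'M[{mpoly k[n]}]_N)
  : Prop :=
  forall p q : 'I_N, (D p q)@_(@mnm0 n) = 0.

(* Main.v *)
Require Import Defs.
From HB Require Import structures.
From mathcomp Require Import all_boot all_order all_algebra.
From mathcomp Require Import mpoly.
From mathcomp Require Import ring.
Set Implicit Arguments. Unset Strict Implicit. Unset Printing Implicit Defensive.
Import GRing.Theory.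
Local Open Scope ring_scope.

(** Let A = {x_i} u {z_k} and B = {y_j} u {z_k}, and let E_A, E_B be the exterior
    algebras with Koszul differential d over A and B.  Write E^+ for the part of
    positive degree, d0 for the degree 0 component of d on E_1 (and 0 on the
    other degrees) and d^+ = d - d0.  The Lyubeznik resolution with xy as first
    generator is

      F = Q + Q f + E_A^+ + f E_A^+ + E_B^+ + f E_B^+        (f sits over xy),

    two Taylor resolutions glued along that of (xy).  For a in E_A^+, b in E_B^+,

      D a = d^+ a + x d0 a,   D (f a) = y a - f d a,   D f = xy,
      D b = d^+ b + y d0 b,   D (f b) = x b - f d b.

    Acyclicity holds because E_A + f E_A is the Koszul complex of A u {y} and
    E_B + f E_B that of B u {x}.  With s the grading involution, the product is

      a * a' = x aa',  b * b' = y bb',  a * b = d0(a) f b + d0(b) f s(a),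
      f g * a = x f ga (g in E_A),      f h * b = y f hb (h in E_B),

    while f g * b = 0, f h * a = 0 for g in E_A^+, h in E_B^+, and f F * f F = 0. *)

(** * Exterior algebras and Koszul complexes *)

(* The exterior algebra on [n.+1] generators is [E + eps E], where [E] is the
   one on the first [n] generators and [eps] is the last generator; a row
   [row_mx a b] stands for [a + eps b]. *)
Fixpoint edim (n : nat) : nat := if n is m.+1 then (edim m + edim m)%N else 1%N.

Fixpoint edeg (n : nat) : 'I_(edim n) -> nat :=
  match n with
  | 0 => fun _ => 0%N
  | m.+1 => fun p : 'I_(edim m + edim m) =>
      match split p with inl i => edeg i | inr i => (edeg i).+1 end
  end.

Section Exterior.
Variable Q : comNzRingType.

Local Notation ext n := 'rV[Q]_(edim n).

(* Homogeneity of degree [i - 1], where degree [-1] contains only [0]. *)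
Definition inFpred (N : nat) (deg : 'I_N -> nat) (i : nat) (v : 'rV[Q]_N) :=
  if i is j.+1 then inF deg j v else v = 0.

Fixpoint eone (n : nat) : ext n :=
  match n with
  | 0 => const_mx 1
  | m.+1 => row_mx (eone m) 0
  end.

(* The grading involution [u |-> (-1)^|u| u]. *)
Fixpoint esg (n : nat) : ext n -> ext n :=
  match n with
  | 0 => id
  | m.+1 => fun u : 'rV_(edim m + edim m) =>
      row_mx (esg (lsubmx u)) (- esg (rsubmx u))
  end.

(** The product [(a + eps b)(a' + eps b')] is expanded with [eps^2 = 0] and [a eps = eps s(a)]. *)
Fixpoint emul (n : nat) : ext n -> ext n -> ext n :=
  match n with
  | 0 => fun u v => u 0 0 *: v
  | m.+1 => fun u v : 'rV_(edim m + edim m) =>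
      row_mx (emul (lsubmx u) (lsubmx v))
             (emul (rsubmx u) (lsubmx v) + emul (esg (lsubmx u)) (rsubmx v))
  end.

(** The augmentation, that is, the coefficient of [eone]. *)
Fixpoint esc (n : nat) : ext n -> Q :=
  match n with
  | 0 => fun u => u 0 0
  | m.+1 => fun u : 'rV_(edim m + edim m) => esc (lsubmx u)
  end.

(** The Koszul differential, with the last generator [eps] sent to [t m]; the minus sign comes from
    moving [d] past [eps]. *)
Fixpoint ed (t : nat -> Q) (n : nat) : ext n -> ext n :=
  match n with
  | 0 => fun=> 0
  | m.+1 => fun u : 'rV_(edim m + edim m) =>
      row_mx (ed t (lsubmx u) + t m *: rsubmx u) (- ed t (rsubmx u))
  end.

Lemma ext_split n (u : ext n.+1) : exists a b : ext n, u = row_mx a b.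
Proof.
pose v : 'rV_(edim n + edim n) := u.
by exists (lsubmx v), (rsubmx v); rewrite hsubmxK.
Qed.

Lemma esg_base (u : ext 0) : esg u = u. Proof. by []. Qed.

Lemma emul_base (u v : ext 0) : emul u v = u 0 0 *: v. Proof. by []. Qed.

Lemma esc_base (u : ext 0) : esc u = u 0 0. Proof. by []. Qed.

Lemma ed_base t (u : ext 0) : ed t u = 0. Proof. by []. Qed.

Lemma esgE n (a b : ext n) : @esg n.+1 (row_mx a b) = row_mx (esg a) (- esg b).
Proof. by rewrite /= row_mxKl row_mxKr. Qed.

Lemma emulE n (a b a' b' : ext n) :
  @emul n.+1 (row_mx a b) (row_mx a' b') =
  row_mx (emul a a') (emul b a' + emul (esg a) b').
Proof. by rewrite /= !row_mxKl !row_mxKr. Qed.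

Lemma escE n (a b : ext n) : @esc n.+1 (row_mx a b) = esc a.
Proof. by rewrite /= row_mxKl. Qed.

Lemma edE t n (a b : ext n) :
  @ed t n.+1 (row_mx a b) = row_mx (ed t a + t n *: b) (- ed t b).
Proof. by rewrite /= row_mxKl row_mxKr. Qed.

Local Opaque esg emul esc ed.

Let base := (esg_base, emul_base, esc_base, ed_base).

Lemma inF_zero N (deg : 'I_N -> nat) i : inF deg i (0 : 'rV[Q]_N).
Proof. by move=> p; rewrite mxE eqxx. Qed.

Lemma inF_lin N (deg : 'I_N -> nat) i r (u v : 'rV[Q]_N) :
  inF deg i u -> inF deg i v -> inF deg i (r *: u + v).
Proof.
move=> hu hv p; rewrite !mxE => nz.
have [u0|] := eqVneq (u 0 p) 0; last exact: hu.
by apply: hv; move: nz; rewrite u0 mulr0 add0r.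
Qed.

Lemma inF_add N (deg : 'I_N -> nat) i (u v : 'rV[Q]_N) :
  inF deg i u -> inF deg i v -> inF deg i (u + v).
Proof. by move=> hu hv; rewrite -[u]scale1r; apply: inF_lin. Qed.

Lemma inF_scale N (deg : 'I_N -> nat) i r (u : 'rV[Q]_N) :
  inF deg i u -> inF deg i (r *: u).
Proof. by move=> hu; rewrite -[_ *: _]addr0; apply: inF_lin (inF_zero _ _). Qed.

Lemma inF_opp N (deg : 'I_N -> nat) i (u : 'rV[Q]_N) :
  inF deg i u -> inF deg i (- u).
Proof. by move=> hu; rewrite -scaleN1r; apply: inF_scale. Qed.

(** The generator [eps] has degree 1, so its coefficient sits one degree lower and vanishes in
    degree 0. *)
Lemma inF_row n i (a b : ext n) :
  inF (@edeg n.+1) i (row_mx a b) <-> inF (@edeg n) i a /\ inFpred (@edeg n) i b.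
Proof.
split=> [h|[ha hb] p].
  split=> [p nz|].
    have := h (lshift _ p); rewrite row_mxEl => /(_ nz) <- /=.
    by rewrite (unsplitK (inl p)).
  have hr p : b 0 p != 0 -> (edeg p).+1 = i.
    move=> nz; have := h (rshift _ p); rewrite row_mxEr => /(_ nz) <- /=.
    by rewrite (unsplitK (inr p)).
  case: i h hr => [|i] h hr /=; last by move=> p /hr [].
  by apply/rowP => p; rewrite mxE; apply/eqP/negPn/negP => /hr.
rewrite mxE /=; case: split => q; first exact: ha.
case: i ha hb => [|i] ha hb; first by rewrite hb mxE eqxx.
by move=> /hb ->.
Qed.

(** * Algebra laws of the exterior algebra *)

Lemma esgD n (u v : ext n) : esg (u + v) = esg u + esg v.
Proof.
elim: n u v => [|n IH] u v; first by rewrite !base.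
have [a [b ->]] := ext_split u; have [a' [b' ->]] := ext_split v.
by rewrite add_row_mx !esgE !IH add_row_mx opprD.
Qed.

Lemma esgZ n r (u : ext n) : esg (r *: u) = r *: esg u.
Proof.
elim: n u => [|n IH] u; first by rewrite !base.
have [a [b ->]] := ext_split u.
by rewrite scale_row_mx !esgE !IH scale_row_mx scalerN.
Qed.

Lemma esgN n (u : ext n) : esg (- u) = - esg u.
Proof. by rewrite -scaleN1r esgZ scaleN1r. Qed.

Lemma esg0 n : esg (0 : ext n) = 0.
Proof. by have := esgZ 0 (0 : ext n); rewrite !scale0r. Qed.

Lemma esgK n (u : ext n) : esg (esg u) = u.
Proof.
elim: n u => [|n IH] u; first by rewrite !base.
by have [a [b ->]] := ext_split u; rewrite !esgE esgN !IH opprK.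
Qed.

Lemma emulDl n (u v w : ext n) : emul (u + v) w = emul u w + emul v w.
Proof.
elim: n u v w => [|n IH] u v w; first by rewrite !base mxE scalerDl.
have [a [b ->]] := ext_split u; have [a' [b' ->]] := ext_split v.
have [a'' [b'' ->]] := ext_split w.
by rewrite add_row_mx !emulE esgD !IH add_row_mx addrACA.
Qed.

Lemma emulDr n (u v w : ext n) : emul w (u + v) = emul w u + emul w v.
Proof.
elim: n u v w => [|n IH] u v w; first by rewrite !base scalerDr.
have [a [b ->]] := ext_split u; have [a' [b' ->]] := ext_split v.
have [a'' [b'' ->]] := ext_split w.
by rewrite add_row_mx !emulE !IH add_row_mx addrACA.
Qed.

Lemma emulZl n r (u w : ext n) : emul (r *: u) w = r *: emul u w.
Proof.
elim: n u w => [|n IH] u w; first by rewrite !base mxE scalerA.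
have [a [b ->]] := ext_split u; have [a' [b' ->]] := ext_split w.
by rewrite scale_row_mx !emulE esgZ !IH scale_row_mx scalerDr.
Qed.

Lemma emulZr n r (u w : ext n) : emul w (r *: u) = r *: emul w u.
Proof.
elim: n u w => [|n IH] u w; first by rewrite !base !scalerA mulrC.
have [a [b ->]] := ext_split u; have [a' [b' ->]] := ext_split w.
by rewrite scale_row_mx !emulE !IH scale_row_mx scalerDr.
Qed.

Lemma emulNl n (u w : ext n) : emul (- u) w = - emul u w.
Proof. by rewrite -scaleN1r emulZl scaleN1r. Qed.

Lemma emulNr n (u w : ext n) : emul w (- u) = - emul w u.
Proof. by rewrite -scaleN1r emulZr scaleN1r. Qed.

Lemma emul0l n (u : ext n) : emul 0 u = 0.
Proof. by have := emulZl 0 0 u; rewrite !scale0r. Qed.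

Lemma emul0r n (u : ext n) : emul u 0 = 0.
Proof. by have := emulZr 0 0 u; rewrite !scale0r. Qed.

Lemma esg_one n : esg (eone n) = eone n.
Proof. by elim: n => [|n IH]; rewrite ?base // esgE IH esg0 oppr0. Qed.

Lemma emul1l n (u : ext n) : emul (eone n) u = u.
Proof.
elim: n u => [|n IH] u; first by rewrite !base mxE scale1r.
have [a [b ->]] := ext_split u.
by rewrite emulE esg_one !IH emul0l add0r.
Qed.

Lemma emul1r n (u : ext n) : emul u (eone n) = u.
Proof.
elim: n u => [|n IH] u.
  by apply/rowP => j; rewrite !base !mxE mulr1 (ord1 j).
have [a [b ->]] := ext_split u.
by rewrite emulE !IH emul0r addr0.
Qed.

Lemma esgM n (u v : ext n) : esg (emul u v) = emul (esg u) (esg v).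
Proof.
elim: n u v => [|n IH] u v; first by rewrite !base.
have [a [b ->]] := ext_split u; have [a' [b' ->]] := ext_split v.
rewrite !(emulE, esgE) esgD !IH emulNl emulNr esgK.
by congr row_mx; rewrite opprD.
Qed.

Lemma emulA n (u v w : ext n) : emul (emul u v) w = emul u (emul v w).
Proof.
elim: n u v w => [|n IH] u v w; first by rewrite !base mxE scalerA.
have [a [b ->]] := ext_split u; have [a' [b' ->]] := ext_split v.
have [a'' [b'' ->]] := ext_split w.
by rewrite !emulE esgM emulDl emulDr !IH addrA.
Qed.

Lemma escD n (u v : ext n) : esc (u + v) = esc u + esc v.
Proof.
elim: n u v => [|n IH] u v; first by rewrite !base mxE.
have [a [b ->]] := ext_split u; have [a' [b' ->]] := ext_split v.
by rewrite add_row_mx !escE IH.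
Qed.

Lemma escZ n r (u : ext n) : esc (r *: u) = r * esc u.
Proof.
elim: n u => [|n IH] u; first by rewrite !base mxE.
by have [a [b ->]] := ext_split u; rewrite scale_row_mx !escE IH.
Qed.

Lemma escN n (u : ext n) : esc (- u) = - esc u.
Proof. by rewrite -scaleN1r escZ mulN1r. Qed.

Lemma esc0 n : esc (0 : ext n) = 0.
Proof. by have := escZ 0 (0 : ext n); rewrite scale0r mul0r. Qed.

Lemma esc_one n : esc (eone n) = 1.
Proof. by elim: n => [|n IH]; rewrite ?escE // base mxE. Qed.

Lemma esc_sg n (u : ext n) : esc (esg u) = esc u.
Proof.
elim: n u => [|n IH] u; first by rewrite !base.
by have [a [b ->]] := ext_split u; rewrite esgE !escE.
Qed.

Lemma escM n (u v : ext n) : esc (emul u v) = esc u * esc v.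
Proof.
elim: n u v => [|n IH] u v; first by rewrite !base mxE.
have [a [b ->]] := ext_split u; have [a' [b' ->]] := ext_split v.
by rewrite emulE !escE.
Qed.

(** * The Koszul differential is a derivation of square zero *)

Lemma edD t n (u v : ext n) : ed t (u + v) = ed t u + ed t v.
Proof.
elim: n u v => [|n IH] u v; first by rewrite !base addr0.
have [a [b ->]] := ext_split u; have [a' [b' ->]] := ext_split v.
by rewrite add_row_mx !edE !IH add_row_mx scalerDr opprD addrACA.
Qed.

Lemma edZ t n r (u : ext n) : ed t (r *: u) = r *: ed t u.
Proof.
elim: n u => [|n IH] u; first by rewrite !base scaler0.
have [a [b ->]] := ext_split u.
by rewrite scale_row_mx !edE !IH scale_row_mx scalerDr scalerN !scalerA mulrC.
Qed.

Lemma edN t n (u : ext n) : ed t (- u) = - ed t u.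
Proof. by rewrite -scaleN1r edZ scaleN1r. Qed.

Lemma ed0 t n : ed t (0 : ext n) = 0.
Proof. by have := edZ t 0 (0 : ext n); rewrite !scale0r. Qed.

Lemma ed_one t n : ed t (eone n) = 0.
Proof.
elim: n => [|n IH]; first by rewrite base.
by rewrite edE IH ed0 scaler0 oppr0 addr0 row_mx0.
Qed.

Lemma ed_sg t n (u : ext n) : ed t (esg u) = - esg (ed t u).
Proof.
elim: n u => [|n IH] u; first by rewrite !base oppr0.
have [a [b ->]] := ext_split u.
rewrite !(edE, esgE) edN !IH esgD esgZ esgN opp_row_mx.
by congr row_mx; rewrite ?opprK // opprD scalerN.
Qed.

Lemma ed_ed t n (u : ext n) : ed t (ed t u) = 0.
Proof.
elim: n u => [|n IH] u; first by rewrite !base.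
have [a [b ->]] := ext_split u.
by rewrite !edE edN edD edZ !IH add0r scalerN subrr !oppr0 row_mx0.
Qed.

Lemma edM t n (u v : ext n) :
  ed t (emul u v) = emul (ed t u) v + emul (esg u) (ed t v).
Proof.
elim: n u v => [|n IH] u v; first by rewrite !base mxE scale0r scaler0 addr0.
have [a [b ->]] := ext_split u; have [a' [b' ->]] := ext_split v.
rewrite !(emulE, edE, esgE) add_row_mx edD !IH ed_sg.
rewrite !(esgD, esgZ, emulDl, emulDr, emulZl, emulZr, emulNl, emulNr, esgK).
by congr row_mx; apply/rowP => j; rewrite !mxE; ring.
Qed.

(** * Degrees and signs of homogeneous elements *)

Lemma esg_inF n i (u : ext n) : inF (@edeg n) i u -> esg u = (-1) ^+ i *: u.
Proof.
elim: n i u => [|n IH] i u h.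
  have [->|nz] := eqVneq u 0; first by rewrite !base scaler0.
  suff -> : i = 0%N by rewrite expr0 scale1r.
  rewrite -(h 0) //; apply: contraNneq nz => u0; apply/eqP/rowP => j.
  by rewrite (ord1 j) u0 mxE.
have [a [b ub]] := ext_split u; rewrite {}ub in h *.
case/inF_row: h => ha hb; rewrite esgE scale_row_mx (IH _ _ ha).
congr row_mx; case: i ha hb => [|i] _ hb.
  by rewrite hb esg0 scaler0 oppr0.
by rewrite (IH _ _ hb) exprS mulN1r scaleNr.
Qed.

Lemma emul_inF n i j (u v : ext n) :
  inF (@edeg n) i u -> inF (@edeg n) j v -> inF (@edeg n) (i + j) (emul u v).
Proof.
elim: n i j u v => [|n IH] i j u v hu hv.
  move=> p; rewrite base mxE (ord1 p) => nz.
  have nu : u 0 0 != 0 by apply: contraNneq nz => ->; rewrite mul0r.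
  have nv : v 0 0 != 0 by apply: contraNneq nz => ->; rewrite mulr0.
  by rewrite -(hu _ nu) -(hv _ nv).
have [a [b ub]] := ext_split u; rewrite {}ub in hu *.
have [a' [b' vb]] := ext_split v; rewrite {}vb in hv *.
case/inF_row: hu => ha hb; case/inF_row: hv => ha' hb'.
rewrite emulE; apply/inF_row; split; first exact: IH.
rewrite (esg_inF ha) emulZl.
have h1 : inFpred (@edeg n) (i + j) (emul b a').
  case: i {ha} hb => [|i] /= hb; last exact: IH.
  by rewrite hb emul0l; case: j {ha' hb'} => //= j; apply: inF_zero.
have h2 : inFpred (@edeg n) (i + j) (emul a b').
  case: j {ha' h1} hb' => [|j] /= hb'; last by rewrite addnS; apply: IH.
  by rewrite hb' emul0r; case: (i + 0)%N => //= ?; apply: inF_zero.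
case: (i + j)%N h1 h2 => [|k] /=; first by move=> -> ->; rewrite scaler0 addr0.
by move=> h1 h2; rewrite addrC; apply: inF_lin.
Qed.

Lemma emulC n i j (u v : ext n) :
  inF (@edeg n) i u -> inF (@edeg n) j v ->
  emul u v = (-1) ^+ (i * j) *: emul v u.
Proof.
elim: n i j u v => [|n IH] i j u v hu hv.
  apply/rowP => p; rewrite !base !mxE (ord1 p) [v 0 0 * _]mulrC.
  have [->|nz] := eqVneq (u 0 0) 0; first by rewrite !mul0r mulr0.
  by rewrite -(hu _ nz) /= mul0n expr0 mul1r.
have [a [b ub]] := ext_split u; rewrite {}ub in hu *.
have [a' [b' vb]] := ext_split v; rewrite {}vb in hv *.
case/inF_row: hu => ha hb; case/inF_row: hv => ha' hb'.
rewrite !emulE scale_row_mx (IH _ _ _ _ ha ha') (esg_inF ha) (esg_inF ha').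
rewrite !emulZl; congr row_mx; rewrite scalerDr scalerA addrC; congr (_ + _).
  case: j {ha'} hb' => [|j] hb'; first by rewrite hb' emul0l emul0r !scaler0.
  rewrite (IH _ _ _ _ ha hb') scalerA; congr (_ *: _).
  by rewrite -exprD mulnS.
case: i {ha} hb => [|i] hb; first by rewrite hb emul0l emul0r !scaler0.
rewrite (IH _ _ _ _ hb ha'); congr (_ *: _).
by rewrite -exprD mulSn addnAC addnn exprD -(signr_odd _ j.*2) odd_double mul1r.
Qed.

(** The cross terms are [b a] and [s(a) b = - a b]; they cancel because [b] has even degree. Nothing
    is divided by 2, so every characteristic is covered. *)
Lemma emul_sqr n i (u : ext n) : odd i -> inF (@edeg n) i u -> emul u u = 0.
Proof.
elim: n i u => [|n IH] i u oi hu.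
  have [z|nz] := eqVneq (u 0 0) 0; first by rewrite !base z scale0r.
  by move: oi; rewrite -(hu _ nz).
have [a [b ub]] := ext_split u; rewrite {}ub in hu *.
case/inF_row: hu => ha hb.
rewrite emulE (IH i) // (esg_inF ha) emulZl.
case: i oi ha hb => // i /= ei ha hb.
rewrite (emulC hb ha) -scalerDl.
by rewrite mulnS exprD -signr_odd (negbTE ei) -[(-1) ^+ (i * i)]signr_odd oddM
  (negbTE ei) exprS -[(-1) ^+ i]signr_odd (negbTE ei) !expr0 mulr1 mulr1 subrr
  scale0r row_mx0.
Qed.

Lemma ed_inF t n i (u : ext n) :
  inF (@edeg n) i u -> inFpred (@edeg n) i (ed t u).
Proof.
elim: n i u => [|n IH] i u hu.
  by rewrite base; case: i {hu} => // i; apply: inF_zero.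
have [a [b ub]] := ext_split u; rewrite {}ub in hu *.
case/inF_row: hu => ha hb; rewrite edE.
have := IH _ _ ha; case: i {ha} hb => [|i] /= hb da.
  by rewrite da hb ed0 scaler0 addr0 oppr0 row_mx0.
apply/inF_row; split; first by rewrite addrC; apply: inF_lin.
have := IH _ _ hb; case: i {hb da} => [->|i] /=; first by rewrite oppr0.
exact: inF_opp.
Qed.

Lemma edeg0_esc n (u : ext n) i : edeg i = 0%N -> u 0 i = esc u.
Proof.
elim: n u i => [|n IH] u i; first by rewrite !base (ord1 i).
have [a [b ->]] := ext_split u; rewrite escE mxE /=.
by case: split => // j /IH.
Qed.

Lemma inF_one n : inF (@edeg n) 0 (eone n).
Proof.
elim: n => [p _ //|n IH]; apply/inF_row; split => //.
Qed.

Lemma inF0_esc n (u : ext n) : inF (@edeg n) 0 u -> u = esc u *: eone n.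
Proof.
elim: n u => [|n IH] u hu; first by apply/rowP => j; rewrite base !mxE mulr1 (ord1 j).
have [a [b ub]] := ext_split u; rewrite {}ub in hu *.
case/inF_row: hu => ha /= ->; rewrite escE scale_row_mx scaler0.
by rewrite -IH.
Qed.

Lemma inF_esc n i (u : ext n) : inF (@edeg n) i.+1 u -> esc u = 0.
Proof.
elim: n u => [|n IH] u hu.
  by rewrite base; apply/eqP/negPn/negP => /hu.
have [a [b ub]] := ext_split u; rewrite {}ub in hu *.
by case/inF_row: hu => ha _; rewrite escE IH.
Qed.

(** The scalar part of [ed t u] is a linear combination of the [t i], so it lies in every ideal [P]
    containing them. Kernels, multiples of a variable and colon ideals all serve as [P] below. *)
Lemma esc_ed_ideal t n (P : Q -> Prop) :
  P 0 -> (forall p q, P p -> P q -> P (p + q)) -> (forall r p, P p -> P (r * p)) ->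
  (forall i, (i < n)%N -> P (t i)) -> forall u : ext n, P (esc (ed t u)).
Proof.
move=> P0 PD PM; elim: n => [|n IH] Pt u; first by rewrite !base mxE.
have [a [b ->]] := ext_split u.
rewrite edE escE escD escZ; apply: PD.
  by apply: IH => i lt_in; apply: Pt; apply: ltnW.
by rewrite mulrC; apply: PM; apply: Pt.
Qed.

Lemma esc_ed_mem t n i : (i < n)%N ->
  exists2 u : ext n, inF (@edeg n) 1 u & esc (ed t u) = t i.
Proof.
elim: n => // n IH; rewrite ltnS leq_eqVlt => /orP[/eqP ->|/IH [u hu eu]].
  exists (row_mx 0 (eone n)).
    by apply/inF_row; split; [apply: inF_zero|apply: inF_one].
  by rewrite edE escE ed0 add0r escZ esc_one mulr1.
exists (row_mx u 0).
  by apply/inF_row; split=> //; apply: inF_zero.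
by rewrite edE escE scaler0 addr0.
Qed.

(* The Koszul complex is an iterated mapping cone, so acyclicity is
   inherited from n to n.+1 as soon as t n is regular modulo the preceding t i. *)
Lemma ed_exact t n :
  (forall m (c : Q) (u : ext m), (m < n)%N -> inF (@edeg m) 1 u ->
     esc (ed t u) = t m * c ->
     exists2 w : ext m, inF (@edeg m) 1 w & esc (ed t w) = c) ->
  forall i (u : ext n), inF (@edeg n) i.+1 u -> ed t u = 0 ->
  exists2 w : ext n, inF (@edeg n) i.+2 w & ed t w = u.
Proof.
elim: n => [|n IH] reg i u hu.
  move=> _; exists 0; first exact: inF_zero.
  apply/rowP => j; rewrite !base mxE; apply/esym/eqP/negPn/negP.
  by move=> /hu.
have {}IH := IH (fun m c u lt_mn => reg m c u (ltnW lt_mn)).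
have [a [b ub]] := ext_split u; rewrite {}ub in hu *.
case/inF_row: hu => ha hb; rewrite edE.
rewrite -[0]row_mx0 => /eq_row_mx [ea /eqP].
rewrite oppr_eq0 => /eqP eb.
(* [b] is a cycle. In positive degree it bounds by induction; in degree 0 the relation
   [ed t a = - t n b] lets regularity supply the preimage. *)
have [w hw ew] : exists2 w : ext n, inF (@edeg n) i.+1 w & ed t w = b.
  case: i ha hb => [|i] ha hb; last exact: IH.
  have [|w hw ew] := reg n (esc b) (- a) (ltnSn n) (inF_opp ha).
    rewrite edN escN; move/eqP: ea; rewrite addr_eq0 => /eqP ->.
    by rewrite escN opprK escZ.
  exists w => //; rewrite (inF0_esc hb) -ew; apply: inF0_esc.
  exact: (ed_inF t hw).
(* Adding [t n w] to [a] gives a cycle, hence a boundary [ed t w']; then [w' - eps w] maps to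
   [a + eps b]. *)
have [||w' hw' ew'] := IH i (t n *: w + a).
- exact: inF_lin.
- by rewrite edD edZ ew addrC.
exists (row_mx w' (- w)).
  by apply/inF_row; split=> //; apply: inF_opp.
by rewrite edE edN opprK ew ew' scalerN addrAC subrr add0r.
Qed.

End Exterior.

Local Opaque esg emul esc ed.

(** * One half of the glued product *)

Section OneSide.
Variables (Q : comNzRingType) (t : nat -> Q) (n : nat).

Local Notation ext := 'rV[Q]_(edim n).
Local Notation hom := (@inF Q _ (@edeg n)).
Local Notation homp := (@inFpred Q _ (@edeg n)).

(** This is [d0] of the overview, read as a scalar; [edp] below is [d^+]. *)
Definition e0 (u : ext) : Q := esc (ed t u).

Definition edp (u : ext) : ext := ed t u - e0 u *: eone Q n.

(* In the notation of the header, an element of the resolution is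
   [q + p f + a + f g + b + f d] with [a], [g] in [E_A^+] and [b], [d] in
   [E_B^+].  [side_mul] and [side_mulf] are the [E_A^+] and [f E_A^+]
   components of a product; they depend on [b] only through the scalar
   [e = e0 b].  The other half is obtained by exchanging [A], [x] and [B], [y]. *)
Definition side_mul (x q q' : Q) (a a' : ext) : ext :=
  q *: a' + q' *: a + x *: emul a a'.

Definition side_mulf (x q p : Q) (a g : ext) (e : Q) (q' p' : Q) (a' g' : ext) (e' : Q)
    : ext :=
  q *: g' + q' *: g
  + x *: (p *: a' + p' *: esg a + emul g a' + emul (esg a) g')
  + e' *: esg a + e *: a'.

Lemma e0D u v : e0 (u + v) = e0 u + e0 v.
Proof. by rewrite /e0 edD escD. Qed.

Lemma e0Z r u : e0 (r *: u) = r * e0 u.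
Proof. by rewrite /e0 edZ escZ. Qed.

Lemma e0N u : e0 (- u) = - e0 u.
Proof. by rewrite /e0 edN escN. Qed.

Lemma e0_0 : e0 0 = 0.
Proof. by rewrite /e0 ed0 esc0. Qed.

Lemma e0_sg u : e0 (esg u) = - e0 u.
Proof. by rewrite /e0 ed_sg escN esc_sg. Qed.

Lemma e0_edp u : e0 (edp u) = 0.
Proof. by rewrite /e0 /edp edD edN edZ ed_one ed_ed scaler0 subr0 esc0. Qed.

Lemma e0M u v : esc u = 0 -> esc v = 0 -> e0 (emul u v) = 0.
Proof. by move=> hu hv; rewrite /e0 edM escD !escM esc_sg hu hv mulr0 mul0r addr0. Qed.

Lemma edpD u v : edp (u + v) = edp u + edp v.
Proof. by rewrite /edp edD e0D scalerDl opprD addrACA. Qed.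

Lemma edpZ r u : edp (r *: u) = r *: edp u.
Proof. by rewrite /edp edZ e0Z -scalerA -scalerBr. Qed.

Lemma edpN u : edp (- u) = - edp u.
Proof. by rewrite -scaleN1r edpZ scaleN1r. Qed.

Lemma edp0 : edp 0 = 0.
Proof. by rewrite /edp ed0 e0_0 scale0r subrr. Qed.

Lemma esc_edp u : esc (edp u) = 0.
Proof. by rewrite /edp escD escN escZ esc_one mulr1 subrr. Qed.

Lemma edp_edp u : edp (edp u) = 0.
Proof.
rewrite {1}/edp e0_edp scale0r subr0 /edp edD edN edZ ed_one ed_ed.
by rewrite scaler0 subr0.
Qed.

Lemma edp_sg u : edp (esg u) = - esg (edp u).
Proof.
by rewrite /edp e0_sg ed_sg esgD esgN esgZ esg_one scaleNr opprD.
Qed.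

(** The last two terms are the scalar parts of [ed u] and [ed v], which [edp] drops. In the glued
    differential the degree 0 component [x d0] supplies them again. *)
Lemma edpM u v : esc u = 0 -> esc v = 0 ->
  edp (emul u v) = emul (edp u) v + emul (esg u) (edp v) + e0 u *: v + e0 v *: esg u.
Proof.
move=> hu hv; rewrite {1}/edp e0M // scale0r subr0 edM /edp.
rewrite !(emulDl, emulDr, emulNl, emulNr, emulZl, emulZr, emul1l, emul1r).
by apply/rowP => j; rewrite !mxE; ring.
Qed.

Lemma esc_side_mul x q q' a a' : esc a = 0 -> esc a' = 0 -> esc (side_mul x q q' a a') = 0.
Proof. by move=> ha ha'; rewrite /side_mul !(escD, escZ, escM) ha ha'; ring. Qed.

Lemma esc_side_mulf x q p a g e q' p' a' g' e' :
  esc a = 0 -> esc g = 0 -> esc a' = 0 -> esc g' = 0 ->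
  esc (side_mulf x q p a g e q' p' a' g' e') = 0.
Proof.
by move=> ha hg ha' hg'; rewrite /side_mulf !(escD, escZ, escM, esc_sg) ha hg ha' hg'; ring.
Qed.

Lemma e0_side_mul x q q' a a' : esc a = 0 -> esc a' = 0 ->
  e0 (side_mul x q q' a a') = q * e0 a' + q' * e0 a.
Proof. by move=> ha ha'; rewrite /side_mul !(e0D, e0Z) e0M // mulr0 addr0. Qed.

Lemma e0_side_mulf x q p a g e q' p' a' g' e' :
  esc a = 0 -> esc g = 0 -> esc a' = 0 -> esc g' = 0 ->
  e0 (side_mulf x q p a g e q' p' a' g' e') =
  q * e0 g' + q' * e0 g + x * (p * e0 a' - p' * e0 a) - e' * e0 a + e * e0 a'.
Proof.
move=> ha hg ha' hg'; rewrite /side_mulf !(e0D, e0Z, e0_sg) (e0M hg ha').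
by rewrite e0M ?esc_sg //; ring.
Qed.

Ltac lin := rewrite ?(esgD, esgZ, esgN, esgM, emulDl, emulDr, emulZl, emulZr,
  emulNl, emulNr, esgK, emulA); apply/rowP => j; rewrite !mxE; ring.

Lemma side_mul_assoc x q1 q2 q3 a1 a2 a3 :
  side_mul x (q1 * q2) q3 (side_mul x q1 q2 a1 a2) a3 =
  side_mul x q1 (q2 * q3) a1 (side_mul x q2 q3 a2 a3).
Proof. rewrite /side_mul; lin. Qed.

(** The arguments [q1 * e2 + q2 * e1] and [q2 * e3 + q3 * e2] are the values of [e0] on products of
    the other side, as given by [e0_side_mul]. *)
Lemma side_mulf_assoc x q1 p1 a1 g1 e1 q2 p2 a2 g2 e2 q3 p3 a3 g3 e3 :
  side_mulf x (q1 * q2) (q1 * p2 + p1 * q2) (side_mul x q1 q2 a1 a2)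
    (side_mulf x q1 p1 a1 g1 e1 q2 p2 a2 g2 e2) (q1 * e2 + q2 * e1) q3 p3 a3 g3 e3 =
  side_mulf x q1 p1 a1 g1 e1 (q2 * q3) (q2 * p3 + p2 * q3) (side_mul x q2 q3 a2 a3)
    (side_mulf x q2 p2 a2 g2 e2 q3 p3 a3 g3 e3) (q2 * e3 + q3 * e2).
Proof. rewrite /side_mul /side_mulf; lin. Qed.

(** The scalar [x * e0 a + y * e + x * y * p] is the degree 0 component of the glued differential,
    and [y *: g] comes from [D (f g) = y g - f d g]. *)
Lemma side_mul_leibniz x y q p a g e q' p' a' g' e' : esc a = 0 -> esc a' = 0 ->
  edp (side_mul x q q' a a') + y *: side_mulf x q p a g e q' p' a' g' e' =
  side_mul x (x * e0 a + y * e + x * y * p) q' (edp a + y *: g) a'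
  + side_mul x q (x * e0 a' + y * e' + x * y * p') (esg a) (edp a' + y *: g').
Proof. move=> ha ha'; rewrite /side_mul /side_mulf !(edpD, edpZ) edpM //; lin. Qed.

(** Here [h] stands for [e0] of the [f] component of the other side: [- e0 g - h] is the coefficient
    of [f] in the differential, and [x * h] is [e0] of its component on the other side. *)
Lemma side_mulf_leibniz x y q p a g e h q' p' a' g' e' h' :
  esc a = 0 -> esc g = 0 -> esc a' = 0 -> esc g' = 0 ->
  - edp (side_mulf x q p a g e q' p' a' g' e') =
  side_mulf x (x * e0 a + y * e + x * y * p) (- e0 g - h) (edp a + y *: g) (- edp g)
     (x * h) q' p' a' g' e'
  + side_mulf x q (- p) (esg a) (- esg g) (- e) (x * e0 a' + y * e' + x * y * p')
     (- e0 g' - h') (edp a' + y *: g') (- edp g') (x * h').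
Proof.
move=> ha hg ha' hg'; rewrite /side_mulf !(edpD, edpZ, edp_sg) (edpM hg ha') edpM ?esc_sg //.
rewrite edp_sg e0_sg; lin.
Qed.

Lemma inFpred_lin i r u v : homp i u -> homp i v -> homp i (r *: u + v).
Proof.
by case: i => [-> ->|i] /=; [rewrite scaler0 addr0|apply: inF_lin].
Qed.

Lemma inFpred_zero i : homp i (0 : ext).
Proof. by case: i => //= i; apply: inF_zero. Qed.

Lemma inFpred_scale i r u : homp i u -> homp i (r *: u).
Proof. by move=> hu; rewrite -[_ *: _]addr0; apply: inFpred_lin (inFpred_zero _). Qed.

Lemma inFpred_add i u v : homp i u -> homp i v -> homp i (u + v).
Proof. by move=> hu; rewrite -[u]scale1r; apply: inFpred_lin. Qed.

Lemma emul_inFpl i j u v : homp i u -> hom j v -> homp (i + j) (emul u v).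
Proof.
case: i => [-> _|i hu hv]; first by rewrite emul0l; apply: inFpred_zero.
exact: emul_inF.
Qed.

Lemma emul_inFpr i j u v : hom i u -> homp j v -> homp (i + j) (emul u v).
Proof.
case: j => [_ ->|j hu hv]; first by rewrite emul0r; apply: inFpred_zero.
by rewrite addnS; apply: emul_inF.
Qed.

Lemma e0_inF i u : hom i u -> i != 1%N -> e0 u = 0.
Proof.
move=> /(ed_inF t); rewrite /e0; case: i => [->|[//|i]] /=; first by rewrite esc0.
by move=> /inF_esc.
Qed.

Lemma e0_inFpred i u : homp i u -> i != 2%N -> e0 u = 0.
Proof.
case: i => [->|i hu ne]; first by rewrite e0_0.
exact: e0_inF hu _.
Qed.

Lemma edp_inF i u : hom i.+1 u -> hom i (edp u).
Proof.
move=> hu; have hd : hom i (ed t u) := ed_inF t hu.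
rewrite /edp; case: i hu hd => [|i] hu hd.
  by rewrite {1}(inF0_esc hd) subrr; apply: inF_zero.
by rewrite (e0_inF hu) // scale0r subr0.
Qed.

Lemma edp_inF0 u : hom 0 u -> edp u = 0.
Proof. by move=> hu; rewrite /edp (e0_inF hu) // scale0r subr0; apply: (ed_inF t hu). Qed.

Lemma edp_inFpred i u : homp i.+1 u -> homp i (edp u).
Proof. by case: i => [|i] /=; [apply: edp_inF0|apply: edp_inF]. Qed.

Lemma side_mul_inF x q q' a a' i j : (i != 0%N -> q = 0) -> (j != 0%N -> q' = 0) ->
  hom i a -> hom j a' -> hom (i + j) (side_mul x q q' a a').
Proof.
move=> hq hq' ha ha'; apply: inF_add; last by apply: inF_scale; apply: emul_inF.
apply: inF_add.
  case: i hq {ha} => [|i] hq; first exact: inF_scale.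
  by rewrite hq // scale0r; apply: inF_zero.
case: j hq' {ha'} => [|j] hq'; first by rewrite addn0; apply: inF_scale.
by rewrite hq' // scale0r; apply: inF_zero.
Qed.

(** The implications say that the scalars are homogeneous: [q] belongs to [1] in degree 0, [p] to
    [f] in degree 1, and [e] behaves like [p] because [d0] lives on degree 1. *)
Lemma side_mulf_inF x q p a g e q' p' a' g' e' i j :
  (i != 0%N -> q = 0) -> (i != 1%N -> p = 0) -> (i != 1%N -> e = 0) ->
  (j != 0%N -> q' = 0) -> (j != 1%N -> p' = 0) -> (j != 1%N -> e' = 0) ->
  hom i a -> homp i g -> hom j a' -> homp j g' ->
  homp (i + j) (side_mulf x q p a g e q' p' a' g' e').
Proof.
move=> hq hp he hq' hp' he' ha hg ha' hg'.
have degl r : (i != 1%N -> r = 0) -> homp (i + j) (r *: a').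
  case: (eqVneq i 1%N) => [-> _|_ -> //]; first exact: inF_scale.
  by rewrite scale0r; apply: inFpred_zero.
have degr r : (j != 1%N -> r = 0) -> homp (i + j) (r *: esg a).
  rewrite (esg_inF ha); case: (eqVneq j 1%N) => [-> _|_ -> //].
    by rewrite addn1; do 2!apply: inF_scale.
  by rewrite scale0r; apply: inFpred_zero.
apply: inFpred_add; last exact: degl.
apply: inFpred_add; last exact: degr.
apply: inFpred_add.
  apply: inFpred_add.
    case: (eqVneq i 0%N) hq => [-> _|_ -> //]; first exact: inFpred_scale.
    by rewrite scale0r; apply: inFpred_zero.
  case: (eqVneq j 0%N) hq' => [-> _|_ -> //]; first by rewrite addn0; apply: inFpred_scale.
  by rewrite scale0r; apply: inFpred_zero.
apply: inFpred_scale; apply: inFpred_add.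
  apply: inFpred_add; last exact: emul_inFpl.
  by apply: inFpred_add; [apply: degl|apply: degr].
rewrite (esg_inF ha) emulZl; apply: inFpred_scale; exact: emul_inFpr.
Qed.

Lemma sign0 i j (q : Q) : (i != 0%N -> q = 0) -> (-1) ^+ (i * j) * q = q.
Proof. by case: i => [_|i -> //]; rewrite ?mul1r // mulr0. Qed.

Lemma sign1 i j (q : Q) : (i != 1%N -> q = 0) -> (-1) ^+ (i * j) * q = (-1) ^+ j * q.
Proof. by case: (eqVneq i 1%N) => [-> _|_ -> //]; rewrite ?mul1n // !mulr0. Qed.

Lemma side_mul_comm x q q' a a' i j : (i != 0%N -> q = 0) -> (j != 0%N -> q' = 0) ->
  hom i a -> hom j a' -> side_mul x q q' a a' = (-1) ^+ (i * j) *: side_mul x q' q a' a.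
Proof.
move=> hq hq' ha ha'; rewrite /side_mul (emulC ha ha') !scalerDr !scalerA.
rewrite [_ * q]sign0 // [(i * j)%N]mulnC sign0 // [x * _]mulrC.
by congr (_ + _); rewrite addrC.
Qed.

(** The terms correspond in pairs under the exchange of factors: [p a'] with [p s(a')], [g a'] with
    [s(a') g], [e a'] with [e s(a')], each up to the sign [(-1)^(i j)]. *)
Lemma side_mulf_comm x q p a g e q' p' a' g' e' i j :
  (i != 0%N -> q = 0) -> (i != 1%N -> p = 0) -> (i != 1%N -> e = 0) ->
  (j != 0%N -> q' = 0) -> (j != 1%N -> p' = 0) -> (j != 1%N -> e' = 0) ->
  hom i a -> homp i g -> hom j a' -> homp j g' ->
  side_mulf x q p a g e q' p' a' g' e' =
  (-1) ^+ (i * j) *: side_mulf x q' p' a' g' e' q p a g e.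
Proof.
move=> hq hp he hq' hp' he' ha hg ha' hg'.
have sgj r : (i != 1%N -> r = 0) -> r *: a' = (-1) ^+ (i * j) *: (r *: esg a').
  move=> hr; rewrite (esg_inF ha') !scalerA sign1 // mulrAC -expr2 sqrr_sign.
  by rewrite mul1r.
have sgi r : (j != 1%N -> r = 0) -> r *: esg a = (-1) ^+ (i * j) *: (r *: a).
  by move=> hr; rewrite (esg_inF ha) !scalerA mulnC sign1 // mulrC.
have h1 : emul g a' = (-1) ^+ (i * j) *: emul (esg a') g.
  rewrite (esg_inF ha') emulZl scalerA; case: i hg {ha hq hp he sgj sgi} => [->|i hg].
    by rewrite emul0l emul0r scaler0.
  rewrite (emulC (hg : hom i g) ha'); congr (_ *: _).
  by rewrite mulSn exprD mulrAC -expr2 sqrr_sign mul1r.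
have h2 : emul (esg a) g' = (-1) ^+ (i * j) *: emul g' a.
  rewrite (esg_inF ha) emulZl; case: j hg' {ha' hq' hp' he' sgj sgi h1} => [->|j hg'].
    by rewrite emul0l emul0r !scaler0.
  by rewrite (emulC ha (hg' : hom j g')) scalerA -exprD mulnS.
rewrite /side_mulf h1 h2 (sgj p) // (sgj e) // (sgi p') // (sgi e') //.
have h3 : q *: g' = (-1) ^+ (i * j) *: (q *: g') by rewrite scalerA sign0.
have h4 : q' *: g = (-1) ^+ (i * j) *: (q' *: g) by rewrite scalerA mulnC sign0.
rewrite [q *: g' in LHS]h3 [q' *: g in LHS]h4.
by apply/rowP => k; rewrite !mxE; ring.
Qed.

(** In odd degree [s(a) = - a], and [g] has even degree and commutes with [a], so the terms cancel
    in pairs. *)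
Lemma side_mulf_sqr x p a g e i : odd i -> hom i a -> homp i g ->
  side_mulf x 0 p a g e 0 p a g e = 0.
Proof.
move=> oi ha hg; rewrite /side_mulf.
have -> : esg a = - a by rewrite (esg_inF ha) -signr_odd oi scaleN1r.
have -> : emul g a = emul a g.
  case: i oi ha hg => // i /= ei ha hg; rewrite (emulC hg ha).
  by rewrite -signr_odd oddM (negbTE ei) scale1r.
rewrite emulNl; by apply/rowP => k; rewrite !mxE; ring.
Qed.

End OneSide.

(** * The resolution and its product *)

Lemma edeg_bot n : exists i : 'I_(edim n), edeg i = 0%N.
Proof.
elim: n => [|n [i hi]]; first by exists 0.
by exists (lshift _ i : 'I_(edim n.+1)); rewrite /= (unsplitK (inl i)).
Qed.

Definition posidx n := {i : 'I_(edim n) | (0 < edeg i)%N}.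

(* The flag tells whether the factor [f] is present; [None] is the empty subset
   of the generators, which the two sides share. *)
Definition gidx n m := (bool * option (posidx n + posidx m))%type.

Definition gdim n m := #|{: gidx n m}|.

Definition gdeg n m (k : 'I_(gdim n m)) : nat :=
  let: (f, s) := (enum_val k : gidx n m) in
  f + match s with
      | None => 0
      | Some (inl i) => edeg (val i)
      | Some (inr j) => edeg (val j)
      end.

Section Glue.
Variables (Q : comNzRingType) (n m : nat).
Local Notation G := 'rV[Q]_(gdim n m).
Local Notation rank s := (enum_rank (s : gidx n m)).

Definition cS (f : bool) (u : G) : Q := u 0 (rank (f, None)).

(** Padding with 0 in degree 0 puts the component into the full exterior algebra, where [emul] and
    [ed] apply; its scalar part is then always 0. *)
Definition cA (f : bool) (u : G) : 'rV[Q]_(edim n) :=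
  \row_i if insub i is Some i' then u 0 (rank (f, Some (inl i'))) else 0.

Definition cB (f : bool) (u : G) : 'rV[Q]_(edim m) :=
  \row_i if insub i is Some i' then u 0 (rank (f, Some (inr i'))) else 0.

(** Coordinates of degree 0 in [a], [g], [b], [d] are discarded, so components can be read back only
    when their [esc] vanishes. *)
Definition glue (q p : Q) (a g : 'rV[Q]_(edim n)) (b d : 'rV[Q]_(edim m)) : G :=
  \row_k match (enum_val k : gidx n m) with
         | (f, None) => if f then p else q
         | (f, Some (inl i)) => (if f then g else a) 0 (val i)
         | (f, Some (inr j)) => (if f then d else b) 0 (val j)
         end.

(** Splits an identity into six: scalars, [A] side, [B] side, each with its [f] component first. The
    bullets of later proofs follow this order. *)
Lemma glue_ext (u v : G) :
  (forall f, cS f u = cS f v) -> (forall f, cA f u = cA f v) ->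
  (forall f, cB f u = cB f v) -> u = v.
Proof.
move=> hS hA hB; apply/rowP => k; rewrite -(enum_valK k).
case: (enum_val k) => [f [[i|j]|]]; last exact: hS.
  by have /rowP/(_ (val i)) := hA f; rewrite !mxE valK.
by have /rowP/(_ (val j)) := hB f; rewrite !mxE valK.
Qed.

Lemma cS_glue f q p a g b d : cS f (glue q p a g b d) = if f then p else q.
Proof. by rewrite /cS mxE enum_rankK. Qed.

Lemma cA_glue f q p a g b d : esc a = 0 -> esc g = 0 ->
  cA f (glue q p a g b d) = if f then g else a.
Proof.
move=> ha hg; apply/rowP => i; rewrite mxE; case: insubP => [i' _ <-|].
  by rewrite mxE enum_rankK.
by rewrite -leqNgt leqn0 => /eqP hi; case: f; rewrite (edeg0_esc _ hi) ?ha ?hg.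
Qed.

Lemma cB_glue f q p a g b d : esc b = 0 -> esc d = 0 ->
  cB f (glue q p a g b d) = if f then d else b.
Proof.
move=> ha hg; apply/rowP => i; rewrite mxE; case: insubP => [i' _ <-|].
  by rewrite mxE enum_rankK.
by rewrite -leqNgt leqn0 => /eqP hi; case: f; rewrite (edeg0_esc _ hi) ?ha ?hg.
Qed.

Lemma esc_cA f u : esc (cA f u) = 0.
Proof.
have [i hi] := edeg_bot n; rewrite -(edeg0_esc _ hi) mxE.
by case: insubP => // i'; rewrite hi.
Qed.

Lemma esc_cB f u : esc (cB f u) = 0.
Proof.
have [i hi] := edeg_bot m; rewrite -(edeg0_esc _ hi) mxE.
by case: insubP => // i'; rewrite hi.
Qed.

Lemma cSP f r u v : cS f (r *: u + v) = r * cS f u + cS f v.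
Proof. by rewrite /cS !mxE. Qed.

Lemma cAP f r u v : cA f (r *: u + v) = r *: cA f u + cA f v.
Proof.
apply/rowP => i; rewrite !mxE.
by case: insubP => [i' _ _|_]; rewrite ?mxE ?mulr0 ?addr0.
Qed.

Lemma cBP f r u v : cB f (r *: u + v) = r *: cB f u + cB f v.
Proof.
apply/rowP => i; rewrite !mxE.
by case: insubP => [i' _ _|_]; rewrite ?mxE ?mulr0 ?addr0.
Qed.

Lemma cS0 f : cS f 0 = 0.
Proof. by rewrite /cS mxE. Qed.

Lemma cA0 f : cA f 0 = 0.
Proof. by apply/rowP => i; rewrite !mxE; case: insubP => [i' _ _|_]; rewrite ?mxE. Qed.

Lemma cB0 f : cB f 0 = 0.
Proof. by apply/rowP => i; rewrite !mxE; case: insubP => [i' _ _|_]; rewrite ?mxE. Qed.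

Lemma cSZ f r u : cS f (r *: u) = r * cS f u.
Proof. by rewrite -[_ *: _]addr0 cSP cS0 addr0. Qed.

Lemma cAZ f r u : cA f (r *: u) = r *: cA f u.
Proof. by rewrite -[r *: u]addr0 cAP cA0 addr0. Qed.

Lemma cBZ f r u : cB f (r *: u) = r *: cB f u.
Proof. by rewrite -[r *: u]addr0 cBP cB0 addr0. Qed.

Lemma cSD f u v : cS f (u + v) = cS f u + cS f v.
Proof. by rewrite -[u]scale1r cSP scale1r mul1r. Qed.

Lemma cAD f u v : cA f (u + v) = cA f u + cA f v.
Proof. by rewrite -[u]scale1r cAP !scale1r. Qed.

Lemma cBD f u v : cB f (u + v) = cB f u + cB f v.
Proof. by rewrite -[u]scale1r cBP !scale1r. Qed.

Lemma inF_gdeg i (u : G) : inF (@gdeg n m) i u <->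
  [/\ i != 0%N -> cS false u = 0, i != 1%N -> cS true u = 0,
      inF (@edeg n) i (cA false u) /\ inFpred (@edeg n) i (cA true u) &
      inF (@edeg m) i (cB false u) /\ inFpred (@edeg m) i (cB true u)].
Proof.
split=> [h|[hq hp [ha hg] [hb hd]] k].
  have hr s : u 0 (rank s) != 0 -> gdeg (rank s) = i by apply: h.
  have hS (f : bool) : i != f -> cS f u = 0.
    move=> ne; apply/eqP; apply: contraNT ne => /hr.
    by rewrite /gdeg enum_rankK addn0 => ->.
  have hA f k : cA f u 0 k != 0 -> (f + edeg k)%N = i.
    rewrite mxE; case: insubP => [k' _ <- /hr <-|_]; last by rewrite eqxx.
    by rewrite /gdeg enum_rankK.
  have hB f k : cB f u 0 k != 0 -> (f + edeg k)%N = i.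
    rewrite mxE; case: insubP => [k' _ <- /hr <-|_]; last by rewrite eqxx.
    by rewrite /gdeg enum_rankK.
  split; [exact: (hS false)|exact: (hS true)| |].
    split=> [k /hA //|]; case: {h hr hS hB} i hA => [|i] hA.
      by apply/rowP => k; rewrite [RHS]mxE; apply/eqP/negPn/negP => /hA.
    by move=> k /hA [].
  split=> [k /hB //|]; case: {h hr hS hA} i hB => [|i] hB.
    by apply/rowP => k; rewrite [RHS]mxE; apply/eqP/negPn/negP => /hB.
  by move=> k /hB [].
rewrite -(enum_valK k) /gdeg enum_rankK; case: (enum_val k) => f [[j|j]|] nz.
- have {}nz : cA f u 0 (val j) != 0 by rewrite mxE valK.
  case: f nz => nz; last exact: ha.
  by case: i hg {hq hp ha hb hd} => [h|i h]; [rewrite h mxE eqxx in nz|rewrite (h _ nz)].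
- have {}nz : cB f u 0 (val j) != 0 by rewrite mxE valK.
  case: f nz => nz; last exact: hb.
  by case: i hd {hq hp ha hb hg} => [h|i h]; [rewrite h mxE eqxx in nz|rewrite (h _ nz)].
rewrite addn0; apply/esym/eqP; apply: contraNT nz.
by case: f => [/hp|/hq] h; apply/eqP.
Qed.

(** * The dg algebra identities on the glued module *)

Variables (tA tB : nat -> Q) (x y : Q).

Local Notation q := (cS false). Local Notation p := (cS true).
Local Notation al := (cA false). Local Notation ga := (cA true).
Local Notation be := (cB false). Local Notation de := (cB true).
Local Notation eA := (@e0 Q tA n). Local Notation eB := (@e0 Q tB m).

Definition gmul (u v : G) : G :=
  glue (q u * q v) (q u * p v + p u * q v)
    (side_mul x (q u) (q v) (al u) (al v))
    (side_mulf x (q u) (p u) (al u) (ga u) (eB (be u)) (q v) (p v) (al v) (ga v) (eB (be v)))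
    (side_mul y (q u) (q v) (be u) (be v))
    (side_mulf y (q u) (p u) (be u) (de u) (eA (al u)) (q v) (p v) (be v) (de v) (eA (al v))).

(** In [D (f a) = y a - f d a] the scalar part of [d a] contributes to the coefficient of [f], hence
    the terms [- eA (ga u) - eB (de u)]. *)
Definition gd (u : G) : G :=
  glue (x * eA (al u) + y * eB (be u) + x * y * p u) (- eA (ga u) - eB (de u))
    (edp tA (al u) + y *: ga u) (- edp tA (ga u))
    (edp tB (be u) + x *: de u) (- edp tB (de u)).

Definition gsg (u : G) : G :=
  glue (q u) (- p u) (esg (al u)) (- esg (ga u)) (esg (be u)) (- esg (de u)).

Definition gone : G := glue 1 0 0 0 0 0.

Lemma gmulS u v f : cS f (gmul u v) = if f then q u * p v + p u * q v else q u * q v.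
Proof. by rewrite cS_glue. Qed.

Lemma gmulA u v f : cA f (gmul u v) =
  if f then side_mulf x (q u) (p u) (al u) (ga u) (eB (be u))
              (q v) (p v) (al v) (ga v) (eB (be v))
  else side_mul x (q u) (q v) (al u) (al v).
Proof. by rewrite cA_glue ?esc_side_mul ?esc_side_mulf ?esc_cA. Qed.

Lemma gmulB u v f : cB f (gmul u v) =
  if f then side_mulf y (q u) (p u) (be u) (de u) (eA (al u))
              (q v) (p v) (be v) (de v) (eA (al v))
  else side_mul y (q u) (q v) (be u) (be v).
Proof. by rewrite cB_glue ?esc_side_mul ?esc_side_mulf ?esc_cB. Qed.

Lemma gdS u f : cS f (gd u) =
  if f then - eA (ga u) - eB (de u) else x * eA (al u) + y * eB (be u) + x * y * p u.
Proof. by rewrite cS_glue. Qed.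

Lemma gdA u f : cA f (gd u) = if f then - edp tA (ga u) else edp tA (al u) + y *: ga u.
Proof. rewrite cA_glue //; last by rewrite escN esc_edp oppr0.
by rewrite escD 1?escZ esc_edp esc_cA mulr0 addr0. Qed.

Lemma gdB u f : cB f (gd u) = if f then - edp tB (de u) else edp tB (be u) + x *: de u.
Proof. rewrite cB_glue //; last by rewrite escN esc_edp oppr0.
by rewrite escD 1?escZ esc_edp esc_cB mulr0 addr0. Qed.

Lemma gsgS u f : cS f (gsg u) = if f then - p u else q u.
Proof. by rewrite cS_glue. Qed.

Lemma gsgA u f : cA f (gsg u) = if f then - esg (ga u) else esg (al u).
Proof. by rewrite cA_glue //; rewrite ?escN ?esc_sg ?esc_cA ?oppr0. Qed.

Lemma gsgB u f : cB f (gsg u) = if f then - esg (de u) else esg (be u).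
Proof. by rewrite cB_glue //; rewrite ?escN ?esc_sg ?esc_cB ?oppr0. Qed.

Let cE := (gmulS, gmulA, gmulB, gdS, gdA, gdB, gsgS, gsgA, gsgB).

Lemma gmul_assoc u v w : gmul (gmul u v) w = gmul u (gmul v w).
Proof.
apply: glue_ext => [] [].
- by rewrite !cE; ring.
- by rewrite !cE; ring.
- rewrite !cE !e0_side_mul ?esc_cA ?esc_cB //; exact: side_mulf_assoc.
- rewrite !cE; exact: side_mul_assoc.
- rewrite !cE !e0_side_mul ?esc_cA ?esc_cB //; exact: side_mulf_assoc.
- rewrite !cE; exact: side_mul_assoc.
Qed.

Lemma gmul_linl r u v w : gmul (r *: u + v) w = r *: gmul u w + gmul v w.
Proof.
apply: glue_ext => [] []; rewrite !(cSP, cAP, cBP, cE) ?(cSP, cAP, cBP, e0D, e0Z);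
  try ring; rewrite /side_mulf /side_mul ?(esgD, esgZ, emulDl, emulZl);
  by apply/rowP => j; rewrite !mxE; ring.
Qed.

Lemma gmul_linr r u v w : gmul w (r *: u + v) = r *: gmul w u + gmul w v.
Proof.
apply: glue_ext => [] []; rewrite !(cSP, cAP, cBP, cE) ?(cSP, cAP, cBP, e0D, e0Z);
  try ring; rewrite /side_mulf /side_mul ?(emulDr, emulZr);
  by apply/rowP => j; rewrite !mxE; ring.
Qed.

Lemma gd_lin r u v : gd (r *: u + v) = r *: gd u + gd v.
Proof.
apply: glue_ext => [] []; rewrite !(cSP, cAP, cBP, cE) ?(cSP, cAP, cBP, e0D, e0Z, edpD, edpZ);
  try ring; by apply/rowP => j; rewrite !mxE; ring.
Qed.

Lemma gone_unit v : gmul gone v = v /\ gmul v gone = v.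
Proof.
have oS f : cS f gone = if f then 0 else 1 by rewrite cS_glue.
have oA f : cA f gone = 0 by rewrite cA_glue ?esc0 //; case: f.
have oB f : cB f gone = 0 by rewrite cB_glue ?esc0 //; case: f.
split; apply: glue_ext => [] []; rewrite !cE !(oS, oA, oB) ?e0_0 /side_mulf /side_mul;
  try ring; rewrite ?(esg0, emul0l, emul0r);
  by apply/rowP => j; rewrite !mxE; ring.
Qed.

Lemma gd_gd u : gd (gd u) = 0.
Proof.
apply: glue_ext => [] []; rewrite ?cS0 ?cA0 ?cB0 !cE.
- by rewrite !e0N !e0_edp; ring.
(* The multiples of [x * y] coming from the two [f] components cancel against [D f = xy]. *)
- by rewrite !(e0_edp, e0D, e0Z); ring.
- by rewrite edpN edp_edp !oppr0.
- by rewrite !(edp_edp, edpD, edpZ) add0r scalerN subrr.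
- by rewrite edpN edp_edp !oppr0.
- by rewrite !(edp_edp, edpD, edpZ) add0r scalerN subrr.
Qed.

Lemma gd_leibniz u v : gd (gmul u v) = gmul (gd u) v + gmul (gsg u) (gd v).
Proof.
apply: glue_ext => [] []; rewrite ?cSD ?cAD ?cBD !cE.
- by rewrite !e0_side_mulf ?esc_cA ?esc_cB //; ring.
- by rewrite !e0_side_mul ?esc_cA ?esc_cB //; ring.
- rewrite !(e0_edp, e0D, e0Z, e0_sg) !add0r; apply: side_mulf_leibniz; exact: esc_cA.
- apply: side_mul_leibniz; exact: esc_cA.
- rewrite !(e0_edp, e0D, e0Z, e0_sg) !add0r.
  (* Sums and [x * y] are reordered so that [B] and [y] take the place of [A] and [x] in the
     one-sided lemma. *)
  rewrite [- eA (ga u) - _]addrC [- eA (ga v) - _]addrC.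
  rewrite [x * eA _ + _]addrC [x * eA (al v) + _]addrC [x * y]mulrC.
  apply: side_mulf_leibniz; exact: esc_cB.
- rewrite [x * eA _ + _]addrC [x * eA (al v) + _]addrC [x * y]mulrC.
  apply: side_mul_leibniz; exact: esc_cB.
Qed.

Lemma gsg_inF i u : inF (@gdeg n m) i u -> gsg u = (-1) ^+ i *: u.
Proof.
case/inF_gdeg=> hq hp [ha hg] [hb hd].
have sgp k (w : 'rV[Q]_(edim k)) : inFpred (@edeg k) i w -> - esg w = (-1) ^+ i *: w.
  case: i {hq hp ha hg hb hd} => [->|i hw]; first by rewrite esg0 oppr0 scaler0.
  by rewrite (esg_inF hw) exprS mulN1r scaleNr.
apply: glue_ext => [] []; rewrite !cE ?cSZ ?cAZ ?cBZ.
- by case: (eqVneq i 1%N) hp => [-> _|_ -> //]; rewrite ?mulr0 ?oppr0 // mulN1r.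
- by case: (eqVneq i 0%N) hq => [-> _|_ -> //]; rewrite ?mulr0 // mul1r.
- exact: sgp.
- exact: esg_inF.
- exact: sgp.
- exact: esg_inF.
Qed.

Lemma gmul_inF i j u v : inF (@gdeg n m) i u -> inF (@gdeg n m) j v ->
  inF (@gdeg n m) (i + j) (gmul u v).
Proof.
case/inF_gdeg=> hq hp [ha hg] [hb hd]; case/inF_gdeg=> hq' hp' [ha' hg'] [hb' hd'].
apply/inF_gdeg; split; rewrite !cE.
- case: i hq {hp ha hg hb hd} => [_|i -> // _]; last by rewrite mul0r.
  by rewrite add0n => /hq' ->; rewrite mulr0.
- move=> ne; case: i hq hp ne {ha hg hb hd} => [|[|i]] hq hp ne;
    last by rewrite hq // hp //; ring.
    by rewrite hp // hp' //; ring.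
  by rewrite hq // hq' //; ring.
- split; first exact: side_mul_inF.
  by apply: side_mulf_inF => //; apply: e0_inF.
- split; first exact: side_mul_inF.
  by apply: side_mulf_inF => //; apply: e0_inF.
Qed.

Lemma gmul_comm i j u v : inF (@gdeg n m) i u -> inF (@gdeg n m) j v ->
  gmul u v = (-1) ^+ (i * j) *: gmul v u.
Proof.
case/inF_gdeg=> hq hp [ha hg] [hb hd]; case/inF_gdeg=> hq' hp' [ha' hg'] [hb' hd'].
apply: glue_ext => [] []; rewrite ?cSZ ?cAZ ?cBZ !cE.
- have h1 := sign0 j hq; have h2 := sign0 i hq'; rewrite mulnC in h2.
  by rewrite -{1}h1 -{1}h2; ring.
- by rewrite mulrA mulnC sign0 // mulrC.
- by apply: side_mulf_comm => //; apply: e0_inF.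
- exact: side_mul_comm.
- by apply: side_mulf_comm => //; apply: e0_inF.
- exact: side_mul_comm.
Qed.

Lemma gmul_sqr i u : odd i -> inF (@gdeg n m) i u -> gmul u u = 0.
Proof.
move=> oi; case/inF_gdeg=> hq hp [ha hg] [hb hd].
have {}hq : q u = 0 by apply: hq; case: i oi {hp ha hg hb hd}.
apply: glue_ext => [] []; rewrite ?cS0 ?cA0 ?cB0 !cE hq.
- by ring.
- by ring.
- exact: side_mulf_sqr oi ha hg.
- by rewrite /side_mul !scale0r (emul_sqr oi ha) scaler0 !addr0.
- exact: side_mulf_sqr oi hb hd.
- by rewrite /side_mul !scale0r (emul_sqr oi hb) scaler0 !addr0.
Qed.

Lemma gd_inF i u : inF (@gdeg n m) i.+1 u -> inF (@gdeg n m) i (gd u).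
Proof.
case/inF_gdeg=> hq hp [ha hg] [hb hd]; apply/inF_gdeg; split; rewrite !cE.
- move=> ne; rewrite hp // (e0_inF tA ha) // (e0_inF tB hb) //; ring.
- by move=> ne; rewrite (e0_inFpred tA hg) // (e0_inFpred tB hd) //; ring.
- split; first by rewrite addrC; apply: inF_lin => //; apply: edp_inF.
  by rewrite -scaleN1r; apply: inFpred_scale; apply: edp_inFpred.
- split; first by rewrite addrC; apply: inF_lin => //; apply: edp_inF.
  by rewrite -scaleN1r; apply: inFpred_scale; apply: edp_inFpred.
Qed.

Lemma gd_inF0 u : inF (@gdeg n m) 0 u -> gd u = 0.
Proof.
case/inF_gdeg=> hq hp [ha hg] [hb hd].
apply: glue_ext => [] []; rewrite ?cS0 ?cA0 ?cB0 !cE ?hg ?hd ?hp // ?e0_0 ?edp0.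
- by ring.
- by rewrite (e0_inF tA ha) // (e0_inF tB hb) //; ring.
- exact: oppr0.
- by rewrite (edp_inF0 tA ha) scaler0 addr0.
- exact: oppr0.
- by rewrite (edp_inF0 tB hb) scaler0 addr0.
Qed.

End Glue.

(** * Acyclicity *)

(** The values of [e0 t] on degree 1 over [edim k] form the ideal [(t 0, ..., t (k-1))]. The
    condition says that each [t k] is a nonzerodivisor modulo the preceding entries. *)
Definition koszul_regular (Q : comNzRingType) (t : nat -> Q) (n : nat) :=
  forall k (c : Q) (u : 'rV[Q]_(edim k)), (k < n)%N -> inF (@edeg k) 1 u ->
  e0 t u = t k * c -> exists2 w : 'rV[Q]_(edim k), inF (@edeg k) 1 w & e0 t w = c.

(** The two equations together say that [a + eps (g + r)] is a cycle of the Koszul complex on [n.+1]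
    elements, where [eps] plays the role of [f]. A preimage there splits into [a2] and [g1]. *)
Lemma side_exact (Q : comNzRingType) (t : nat -> Q) n i
    (a g : 'rV[Q]_(edim n)) (r : Q) :
  koszul_regular t n.+1 -> (forall c, t n * c = 0 -> c = 0) ->
  inF (@edeg n) i.+1 a -> inF (@edeg n) i g -> esc g = 0 -> (i != 0%N -> r = 0) ->
  edp t a + t n *: g = 0 -> e0 t a + t n * r = 0 ->
  exists a2 g1, [/\ inF (@edeg n) i.+2 a2, inF (@edeg n) i.+1 g1,
    e0 t a2 = 0 /\ edp t a2 + t n *: g1 = a & edp t g1 = - g /\ e0 t g1 = - r].
Proof.
move=> reg can ha hg sg hr eq1 eq2; pose g' := g + r *: eone Q n.
have eq3 : ed t a + t n *: g' = 0.
  have -> : ed t a = edp t a + e0 t a *: eone Q n by rewrite /edp subrK.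
  by rewrite /g' scalerDr addrACA eq1 add0r scalerA -scalerDl eq2 scale0r.
have hg' : inF (@edeg n) i g'.
  rewrite /g' addrC; case: i hr hg {ha} => [|i] hr hg; last by rewrite hr // scale0r add0r.
  by apply: inF_lin => //; apply: inF_one.
(* Applying [d] to [eq3] leaves [t n * d g' = 0], and [t n] can be cancelled. *)
have eq4 : ed t g' = 0.
  apply/rowP => j; rewrite [RHS]mxE; apply: can.
  have /(congr1 (@ed _ t n))/rowP/(_ j) := eq3.
  by rewrite edD edZ ed_ed ed0 add0r !mxE.
have [||w hw ew] := ed_exact reg (i := i) (u := row_mx a g').
- by apply/inF_row.
- by rewrite edE eq3 eq4 oppr0 row_mx0.
have [a2 [g1 wE]] := ext_split w; rewrite {}wE in hw ew.
case/inF_row: hw => ha2 hg1; move: ew; rewrite edE => /eq_row_mx [ea eg].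
(* Scalar parts are compared in [ea], where [a] and [g1] have positive degree. *)
have e2 : e0 t a2 = 0.
  have := congr1 (@esc _ n) ea; rewrite escD escZ (inF_esc ha) (inF_esc hg1).
  by rewrite mulr0 addr0.
have e1 : e0 t g1 = - r.
  rewrite /e0 -[ed t g1]opprK eg escN /g' escD escZ esc_one sg.
  by rewrite add0r mulr1.
exists a2, g1; split => //; split=> //.
  by rewrite /edp e2 scale0r subr0.
rewrite /edp e1 -[ed t g1]opprK eg /g'.
by rewrite opprD scaleNr opprK subrK.
Qed.

(** Serves minimality: the entries of the differential lie in the ideal of the [t i], and [ev] will
    be the constant term. *)
Lemma ed_rmorph0 (Q S : comNzRingType) (ev : {rmorphism Q -> S}) (t : nat -> Q) n :
  (forall i, (i < n)%N -> ev (t i) = 0) ->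
  forall (u : 'rV[Q]_(edim n)) j, ev (ed t u 0 j) = 0.
Proof.
elim: n => [|n IH] ht u j; first by rewrite ed_base mxE rmorph0.
have [a [b ->]] := ext_split u; rewrite edE mxE.
have {}IH := IH (fun i lt_in => ht i (ltnW lt_in)).
case: split => k; rewrite !mxE; last by rewrite rmorphN IH oppr0.
by rewrite rmorphD rmorphM ht // IH mul0r addr0.
Qed.

Section GlueComplex.
Variables (Q : comNzRingType) (n m : nat) (tA tB : nat -> Q) (x y : Q).

Local Notation G := 'rV[Q]_(gdim n m).
Local Notation deg := (@gdeg n m).
Local Notation gd := (@gd Q n m tA tB x y).

Definition gdiff : 'M[Q]_(gdim n m) := lin1_mx gd.

Lemma mul_gdiff (u : G) : u *m gdiff = gd u.
Proof.
pose L := GRing.isLinear.Build _ _ _ _ gd (gd_lin tA tB x y).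
pose f : {linear G -> G} := HB.pack gd L.
exact: (mul_rV_lin1 f u).
Qed.

Lemma gdiff_entry i j : gdiff i j = gd (delta_mx 0 i) 0 j.
Proof. by rewrite mxE. Qed.

Lemma inF_delta (i : 'I_(gdim n m)) : inF deg (deg i) (delta_mx 0 i : G).
Proof. by move=> j; rewrite mxE eqxx /=; case: (eqVneq j i) => [->|] //; rewrite eqxx. Qed.

Lemma gdiff_complex : is_complex deg gdiff.
Proof.
split=> [i j|].
  rewrite gdiff_entry; have := @inF_delta i; case: (deg i) => [/gd_inF0 ->|k /gd_inF].
    by rewrite mxE eqxx.
  by move=> h /h ->.
apply/row_matrixP => i; rewrite row_mul mul_gdiff row0.
have -> : row i gdiff = gd (delta_mx 0 i) by rewrite -mul_gdiff rowE.
exact: gd_gd.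
Qed.

Lemma gdiff_dga : is_dga deg gdiff (@gmul Q n m tA tB x y).
Proof.
split; split.
- exact: gmul_linl.
- exact: gmul_linr.
- by exists (gone Q n m) => v; apply: gone_unit.
- exact: gmul_assoc.
- exact: gmul_inF.
- exact: gmul_comm.
- exact: gmul_sqr.
- move=> i u v hu; rewrite !mul_gdiff gd_leibniz (gsg_inF hu); congr (_ + _).
  have z w : gmul tA tB x y 0 w = 0.
    have := gmul_linl tA tB x y (-1) 0 0 w.
    by rewrite scaler0 addr0 scaleN1r addNr.
  by rewrite -[_ *: u]addr0 gmul_linl z addr0.
Qed.

Lemma gdiff_rmorph0 (S : comNzRingType) (ev : {rmorphism Q -> S}) :
  (forall i, (i < n)%N -> ev (tA i) = 0) -> (forall i, (i < m)%N -> ev (tB i) = 0) ->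
  ev x = 0 -> ev y = 0 -> forall i j, ev (gdiff i j) = 0.
Proof.
move=> hA hB hx hy i j; rewrite gdiff_entry; move: (delta_mx _ _) => u.
have side t k : (forall i, (i < k)%N -> ev (t i) = 0) ->
    forall (w : 'rV[Q]_(edim k)), ev (e0 t w) = 0 /\ forall l, ev (edp t w 0 l) = 0.
  move=> ht w; have e : ev (e0 t w) = 0.
    have [l hl] := edeg_bot k; rewrite /e0 -(edeg0_esc _ hl); exact: ed_rmorph0.
  by split=> // l; rewrite !mxE rmorphB rmorphM e ed_rmorph0 // mul0r subr0.
have [zA zB] := (side tA n hA, side tB m hB).
rewrite mxE; case: (enum_val j) => [[] [[l|l]|]].
- by rewrite mxE rmorphN; have [_ ->] := zA (cA true u); rewrite oppr0.
- by rewrite mxE rmorphN; have [_ ->] := zB (cB true u); rewrite oppr0.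
- rewrite rmorphB rmorphN; have [-> _] := zA (cA true u).
  by have [-> _] := zB (cB true u); rewrite !oppr0 addr0.
- rewrite mxE [X in _ + X]mxE rmorphD rmorphM hy; have [_ ->] := zA (cA false u).
  by rewrite mul0r addr0.
- rewrite mxE [X in _ + X]mxE rmorphD rmorphM hx; have [_ ->] := zB (cB false u).
  by rewrite mul0r addr0.
- by rewrite !rmorphD !rmorphM hx hy !mul0r !addr0.
Qed.

(** The entry just past [A] is [y] and the one past [B] is [x], so that regularity covers the Koszul
    complexes of [A] with [y] and of [B] with [x]. *)
Hypotheses (tAn : tA n = y) (tBm : tB m = x).
Hypotheses (regA : koszul_regular tA n.+1) (regB : koszul_regular tB m.+1).
Hypotheses (canx : forall c, x * c = 0 -> c = 0) (cany : forall c, y * c = 0 -> c = 0).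
Hypothesis xy_coprime : forall c d, x * c = y * d -> exists r, c = y * r.

(** In the scalar equation [x d0(a) + y d0(b) + x y p = 0] coprimality gives [d0(a) = y s].
    Splitting [p] as [(- s) + (p + s)] makes [a + f (g - s)] and [b + f (d + p + s)] cycles of the
    two Koszul complexes, and their preimages are glued. *)
Lemma gd_exact i (v : G) : inF deg i.+1 v -> gd v = 0 ->
  exists2 w : G, inF deg i.+2 w & gd w = v.
Proof.
case/inF_gdeg=> hq hp [ha hg] [hb hd] dv.
have := congr1 (cS false) dv; rewrite gdS cS0 => eq.
have := congr1 (cA false) dv; rewrite gdA cA0 => eA.
have := congr1 (cB false) dv; rewrite gdB cB0 => eB.
have [s es] : exists s, e0 tA (cA false v) = y * s.
  apply: (xy_coprime (d := - (e0 tB (cB false v) + x * cS true v))).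
  apply/eqP; rewrite -subr_eq0 -[X in _ == X]eq; apply/eqP; ring.
have eqA : e0 tA (cA false v) + tA n * - s = 0 by rewrite es tAn; ring.
(* Multiplied by [y], this is the scalar equation with [x d0(a)] written as [x y s]. *)
have eqB : e0 tB (cB false v) + tB m * (cS true v + s) = 0.
  by apply: cany; rewrite tBm -[RHS]eq es; ring.
have rA : i != 0%N -> - s = 0.
  move=> ne; suff -> : s = 0 by rewrite oppr0.
  by apply: cany; rewrite -es; apply: e0_inF ha _.
have rB : i != 0%N -> cS true v + s = 0.
  by move=> ne; rewrite hp // -[s]opprK rA // oppr0 addr0.
have canA c : tA n * c = 0 -> c = 0 by rewrite tAn; apply: cany.
have canB c : tB m * c = 0 -> c = 0 by rewrite tBm; apply: canx.
rewrite -tAn in eA; rewrite -tBm in eB.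
have [a2 [g1 [ha2 hg1 [ea2 eda] [edg eg1]]]] :=
  side_exact regA canA ha hg (esc_cA _ _) rA eA eqA.
have [b2 [d1 [hb2 hd1 [eb2 edb] [edd ed1]]]] :=
  side_exact regB canB hb hd (esc_cB _ _) rB eB eqB.
have [sa2 sg1] := (inF_esc ha2, inF_esc hg1).
have [sb2 sd1] := (inF_esc hb2, inF_esc hd1).
(* Degree [i.+2] has no scalar component, since [1] and [f] have degrees 0 and 1. *)
exists (glue 0 0 a2 g1 b2 d1).
  by apply/inF_gdeg; split; rewrite ?cS_glue ?cA_glue ?cB_glue.
apply: glue_ext => [] []; rewrite ?gdS ?gdA ?gdB ?cS_glue ?cA_glue ?cB_glue //.
- by rewrite eg1 ed1; ring.
- by rewrite ea2 eb2 hq //; ring.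
- by rewrite edg opprK.
- by rewrite -tAn.
- by rewrite edd opprK.
- by rewrite -tBm.
Qed.

Lemma inF0_eq (u v : G) : inF deg 0 u -> inF deg 0 v -> cS false u = cS false v -> u = v.
Proof.
case/inF_gdeg=> _ hp [ha hg] [hb hd]; case/inF_gdeg=> _ hp' [ha' hg'] [hb' hd'] e.
apply: glue_ext => [] [].
- by rewrite hp // hp'.
- exact: e.
- by rewrite hg hg'.
- by rewrite (inF0_esc ha) (inF0_esc ha') !esc_cA.
- by rewrite hd hd'.
- by rewrite (inF0_esc hb) (inF0_esc hb') !esc_cB.
Qed.

Lemma gdeg0 (k : 'I_(gdim n m)) :
  (gdeg k == 0%N) = (k == enum_rank ((false, None) : gidx n m)).
Proof.
rewrite -(inj_eq enum_val_inj) enum_rankK /gdeg.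
case: (enum_val k) => [[] [[[i hi]|[j hj]]|]] //=; rewrite add0n.
  by rewrite eqn0Ngt hi.
by rewrite eqn0Ngt hj.
Qed.

(** The hypothesis describes [I] as [x (A) + y (B) + (xy)], the image of the degree 1 part. *)
Lemma gdiff_resolution (I : Q -> Prop) :
  (forall c, I c <-> exists (a : 'rV[Q]_(edim n)) (b : 'rV[Q]_(edim m)) (r : Q),
     [/\ inF (@edeg n) 1 a, inF (@edeg m) 1 b & c = x * e0 tA a + y * e0 tB b + x * y * r]) ->
  is_free_resolution deg I gdiff.
Proof.
move=> hI; split.
- exact: gdiff_complex.
- by rewrite (eq_card gdeg0) card1.
- move=> i v hv; rewrite mul_gdiff => dv.
  by have [w hw <-] := gd_exact hv dv; exists w => //; rewrite mul_gdiff.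
move=> v hv; have -> : (forall k, gdeg k = 0%N -> I (v 0 k)) <-> I (cS false v).
  split=> [h|h k /eqP]; first by apply: h; apply/eqP; rewrite gdeg0.
  by rewrite gdeg0 => /eqP ->.
split=> [[w hw ->]|/hI [a [b [r [ha hb e]]]]].
  rewrite mul_gdiff gdS; apply/hI.
  case/inF_gdeg: hw => _ _ [ha _] [hb _].
  by exists (cA false w), (cB false w), (cS true w).
have [sa sb] := (inF_esc ha, inF_esc hb).
have hw : inF deg 1 (glue 0 r a 0 b 0).
  by apply/inF_gdeg; split; rewrite ?cS_glue ?cA_glue ?cB_glue ?esc0 //;
    split=> //; apply: inF_zero.
exists (glue 0 r a 0 b 0) => //; rewrite mul_gdiff; apply: inF0_eq => //.
  exact: gd_inF.
by rewrite gdS cS_glue cA_glue ?cB_glue ?esc0.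
Qed.

End GlueComplex.

(** * Edge ideals *)

Section VariableIdeals.
Variables (k : fieldType) (N : nat).
Local Notation Q := {mpoly k[N]}.

(* The ideal generated by the variables in [s] is the kernel of this
   substitution, which makes regularity of sequences of variables immediate. *)
Definition kill (s : seq 'I_N) (p : Q) : Q :=
  p \mPo [tuple if i \in s then 0 else 'X_i | i < N].

Lemma kill0 s : kill s 0 = 0.
Proof. exact: comp_mpoly0. Qed.

Lemma killD s p q : kill s (p + q) = kill s p + kill s q.
Proof. exact: comp_mpolyD. Qed.

Lemma killM s p q : kill s (p * q) = kill s p * kill s q.
Proof. exact: rmorphM. Qed.

Lemma kill_var s i : kill s 'X_i = if i \in s then 0 else 'X_i.
Proof. by rewrite /kill comp_mpolyXU -tnth_nth tnth_mktuple. Qed.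

(** The default of [nth] is used on purpose: the entry at index [size s] is the extra variable [j],
    namely [y] for [A] and [x] for [B]. *)
Definition varseq (j : 'I_N) (s : seq 'I_N) (i : nat) : Q := 'X_(nth j s i).

Lemma mpolyX_neq0 (i : 'I_N) : ('X_i : Q) != 0.
Proof.
apply/eqP => /(congr1 (mcoeff U_(i)))/eqP.
by rewrite mcoeffX eqxx mcoeff0 oner_eq0.
Qed.

Variables (j : 'I_N) (s : seq 'I_N).
Local Notation t := (varseq j s).
Local Notation span m c :=
  (exists2 u : 'rV[Q]_(edim m), inF (@edeg m) 1 u & e0 t u = c).

Lemma kill_e0 m (u : 'rV[Q]_(edim m)) : (m <= size s)%N -> kill (take m s) (e0 t u) = 0.
Proof.
move=> le_ms; apply: (esc_ed_ideal (P := fun c => kill (take m s) c = 0)).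
- exact: kill0.
- by move=> p q hp hq; rewrite killD hp hq addr0.
- by move=> r p hp; rewrite killM hp mulr0.
move=> i lt_im; rewrite kill_var -(nth_take _ lt_im) mem_nth //.
by rewrite size_takel.
Qed.

Lemma span0 m : span m 0.
Proof. by exists 0; [apply: inF_zero|rewrite e0_0]. Qed.

Lemma spanD m c d : span m c -> span m d -> span m (c + d).
Proof. by move=> [u hu <-] [v hv <-]; exists (u + v); [apply: inF_add|rewrite e0D]. Qed.

Lemma spanM m r c : span m c -> span m (r * c).
Proof. by move=> [u hu <-]; exists (r *: u); [apply: inF_scale|rewrite e0Z]. Qed.

Lemma span_var m i : i \in take m s -> span m 'X_i.
Proof.
move=> hi; have lt_i := hi; rewrite -index_mem in lt_i.
have lt_im : (index i (take m s) < m)%N.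
  by apply: leq_trans lt_i _; rewrite size_take_min geq_minl.
have [u hu e] := esc_ed_mem t lt_im; exists u => //.
by rewrite /e0 e /varseq -(nth_take _ lt_im) nth_index.
Qed.

(** The polynomials congruent to their image under the substitution form a subalgebra, so constants
    and variables suffice. *)
Lemma span_sub_kill m p : span m (p - kill (take m s) p).
Proof.
pose P p := span m (p - kill (take m s) p); rewrite -/(P p).
have PM p1 p2 : P p1 -> P p2 -> P (p1 * p2).
  move=> h1 h2; rewrite /P killM.
  have -> : p1 * p2 - kill (take m s) p1 * kill (take m s) p2 =
    p2 * (p1 - kill (take m s) p1)
    + kill (take m s) p1 * (p2 - kill (take m s) p2) by ring.
  by apply: spanD; apply: spanM.
have P1 : P 1 by rewrite /P /kill comp_mpoly1 subrr; apply: span0.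
elim/mpolyind: p => [|c mm p _ _ hp].
  by rewrite /P kill0 subr0; apply: span0.
rewrite /P killD opprD addrACA; apply: spanD => //.
rewrite /kill comp_mpolyZ -scalerBr -mul_mpolyC; apply: spanM.
rewrite -/(kill _ _) -/(P _) mpolyXE_id; apply: big_ind => // i _.
elim: (mm i) => [|l IH]; first by rewrite expr0.
rewrite exprS; apply: PM => //; rewrite /P kill_var.
by case: ifP => [hi|_]; rewrite ?subrr ?subr0; [apply: span_var|apply: span0].
Qed.

Lemma kill_span m c : kill (take m s) c = 0 -> span m c.
Proof. by move=> hc; have := span_sub_kill m c; rewrite hc subr0. Qed.

(** Killing the preceding variables in [e0 t u = t m * c] leaves [t m * kill c = 0] in a domain; so
    [c] is killed and lies in their ideal. *)
Lemma varseq_regular : uniq (rcons s j) -> koszul_regular t (size s).+1.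
Proof.
move=> us m c u lt_m hu e; apply: kill_span; rewrite ltnS in lt_m.
(* [nth j s m] is entry [m] of [rcons s j], also when [m = size s], so uniqueness separates it from
   the earlier entries. *)
have nin : nth j s m \notin take m s.
  have ts : take m s = take m (rcons s j) by rewrite -cats1 takel_cat.
  have ns : nth j s m = nth j (rcons s j) m.
    by rewrite nth_rcons; case: ltngtP lt_m => // ->; rewrite nth_default.
  rewrite ts ns; move: us; rewrite -{1}(cat_take_drop m (rcons s j)).
  rewrite (drop_nth j) ?size_rcons // cat_uniq /=.
  by case/and3P => _ + _; rewrite negb_or => /andP[].
have := kill_e0 u lt_m; rewrite e killM kill_var (negbTE nin) => /eqP.
by rewrite mulf_eq0 (negbTE (mpolyX_neq0 _)) => /eqP.
Qed.

End VariableIdeals.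

(** Setting [X_j] to 0 leaves [X_i * kill c = 0], so [c] lies in the ideal of the single variable
    [X_j]. *)
Lemma var_coprime (k : fieldType) N (i j : 'I_N) (c d : {mpoly k[N]}) :
  i != j -> 'X_i * c = 'X_j * d -> exists r, c = 'X_j * r.
Proof.
move=> ne e; have : kill [:: j] c = 0.
  have /eqP := congr1 (kill [:: j]) e.
  rewrite !killM !kill_var !inE eqxx (negbTE ne) mul0r mulf_eq0.
  by rewrite (negbTE (mpolyX_neq0 _ _)) => /eqP.
case/(@kill_span _ _ j [:: j] 1) => u _ <-.
apply: (esc_ed_ideal (P := fun c => exists r, c = 'X_j * r)).
- by exists 0; rewrite mulr0.
- by move=> _ _ [r ->] [r' ->]; exists (r + r'); rewrite mulrDr.
- by move=> r _ [r' ->]; exists (r * r'); rewrite mulrCA.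
by case=> // _; exists 1; rewrite mulr1.
Qed.

Section EdgeIdeal.
Variables (k : fieldType) (N : nat) (E : rel 'I_N).

Lemma edge_ideal0 : edge_ideal E (0 : {mpoly k[N]}).
Proof.
exists (fun _ _ => 0); rewrite big1 // => u _.
by rewrite big1 // => v _; rewrite mul0r.
Qed.

Lemma edge_idealD (p q : {mpoly k[N]}) :
  edge_ideal E p -> edge_ideal E q -> edge_ideal E (p + q).
Proof.
move=> [f ->] [g ->]; exists (fun u v => f u v + g u v).
rewrite -big_split /=; apply: eq_bigr => u _; rewrite -big_split /=.
by apply: eq_bigr => v _; rewrite mulrDl.
Qed.

Lemma edge_idealM (r p : {mpoly k[N]}) : edge_ideal E p -> edge_ideal E (r * p).
Proof.
move=> [f ->]; exists (fun u v => r * f u v); rewrite mulr_sumr.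
by apply: eq_bigr => u _; rewrite mulr_sumr; apply: eq_bigr => v _; rewrite mulrA.
Qed.

Lemma edge_ideal_edge u v : E u v -> edge_ideal E ('X_u * 'X_v : {mpoly k[N]}).
Proof.
move=> huv; exists (fun u' v' => ((u' == u) && (v' == v))%:R).
rewrite (bigD1 u) //= (bigD1 v) //= !eqxx mul1r !big1 ?addr0 //.
  by move=> u' /negbTE ->; rewrite big1 // => v' _; rewrite mul0r.
by move=> v' /andP[_ /negbTE ->]; rewrite mul0r.
Qed.

End EdgeIdeal.

(** * The resolution of the edge ideal of [L(a,b,c)] *)

Theorem mainTheorem4 (k : fieldType) (a b c : nat) :
  exists (N : nat) (deg : 'I_N -> nat) (D : 'M[{mpoly k[a + b + c + 2]}]_N),
    [/\ is_free_resolution deg (edge_ideal (L_edge a b c)) D,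
        is_minimal D &
        exists mul : 'rV[{mpoly k[a + b + c + 2]}]_N ->
                     'rV[{mpoly k[a + b + c + 2]}]_N ->
                     'rV[{mpoly k[a + b + c + 2]}]_N,
          is_dga deg D mul].
Proof.
have lt0 : (0 < a + b + c + 2)%N by rewrite addn2.
have lt1 : (1 < a + b + c + 2)%N by rewrite addn2.
pose xv := Ordinal lt0; pose yv := Ordinal lt1.
(* [sX] is the set [A] of neighbours of [x] other than [y], and [sY] is the set [B] of neighbours of
   [y] other than [x]. *)
pose sX := [seq v : 'I_(a + b + c + 2) <- enum 'I_(a + b + c + 2) |
             L_isX a b c v || L_isZ a b c v].
pose sY := [seq v : 'I_(a + b + c + 2) <- enum 'I_(a + b + c + 2) |
             L_isY a b c v || L_isZ a b c v].
have memX v : (v \in sX) = L_isX a b c v || L_isZ a b c v.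
  by rewrite mem_filter mem_enum andbT.
have memY v : (v \in sY) = L_isY a b c v || L_isZ a b c v.
  by rewrite mem_filter mem_enum andbT.
have uX : uniq (rcons sX yv).
  by rewrite rcons_uniq filter_uniq ?enum_uniq // memX andbT.
have uY : uniq (rcons sY xv).
  by rewrite rcons_uniq filter_uniq ?enum_uniq // memY andbT.
pose tX := varseq k yv sX; pose tY := varseq k xv sY.
pose X : {mpoly k[a + b + c + 2]} := 'X_xv.
pose Y : {mpoly k[a + b + c + 2]} := 'X_yv.
exists (gdim (size sX) (size sY)), (@gdeg (size sX) (size sY)).
exists (@gdiff _ (size sX) (size sY) tX tY X Y).
have can i (p : {mpoly k[a + b + c + 2]}) : 'X_i * p = 0 -> p = 0.
  by move/eqP; rewrite mulf_eq0 (negbTE (mpolyX_neq0 _ _)) => /eqP.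
split.
- apply: gdiff_resolution.
  + by rewrite /tX /varseq nth_default.
  + by rewrite /tY /varseq nth_default.
  + exact: varseq_regular.
  + exact: varseq_regular.
  + exact: can.
  + exact: can.
  + by move=> p q; apply: var_coprime.
  (* [J] is [x (A) + y (B) + (xy)]. Being an ideal that contains every edge monomial, it contains
     the edge ideal. *)
  pose J p := exists (u : 'rV[{mpoly k[a + b + c + 2]}]_(edim (size sX)))
      (v : 'rV[{mpoly k[a + b + c + 2]}]_(edim (size sY))) r,
    [/\ inF (@edeg (size sX)) 1 u, inF (@edeg (size sY)) 1 v &
        p = X * e0 tX u + Y * e0 tY v + X * Y * r].
  have J0 : J 0.
    by exists 0, 0, 0; split; [apply: inF_zero|apply: inF_zero|rewrite !e0_0; ring].
  have JD p q : J p -> J q -> J (p + q).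
    move=> [u [v [r [hu hv ->]]]] [u' [v' [r' [hu' hv' ->]]]].
    exists (u + u'), (v + v'), (r + r').
    by split; [apply: inF_add|apply: inF_add|rewrite !e0D; ring].
  have JM r p : J p -> J (r * p).
    move=> [u [v [r' [hu hv ->]]]]; exists (r *: u), (r *: v), (r * r').
    by split; [apply: inF_scale|apply: inF_scale|rewrite !e0Z; ring].
  have Jarc (u v : 'I_(a + b + c + 2)) : L_arc a b c u v -> J ('X_u * 'X_v).
    have JX w : w \in sX -> J (X * 'X_w).
      rewrite -{1}[sX]take_size => /span_var-/(_ k yv) [h hh e].
      exists h, 0, 0; split=> //; first exact: inF_zero.
      by rewrite e0_0 e; ring.
    have JY w : w \in sY -> J (Y * 'X_w).
      rewrite -{1}[sY]take_size => /span_var-/(_ k xv) [h hh e].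
      exists 0, h, 0; split=> //; first exact: inF_zero.
      by rewrite e0_0 e; ring.
    have ux : u == 0%N :> nat -> u = xv by move/eqP => h; apply: val_inj.
    have uy : u == 1%N :> nat -> u = yv by move/eqP => h; apply: val_inj.
    case/or4P=> [/andP[/ux -> /eqP hv]|/andP[/ux -> hv]|/andP[/uy -> hv]|].
    + have -> : v = yv by apply: val_inj.
      by exists 0, 0, 1; split; [apply: inF_zero|apply: inF_zero|rewrite !e0_0 /X /Y; ring].
    + by apply: JX; rewrite memX hv.
    + by apply: JY; rewrite memY hv.
    case/orP=> [/andP[/ux -> hv]|/andP[/uy -> hv]].
      by apply: JX; rewrite memX hv orbT.
    by apply: JY; rewrite memY hv orbT.
  move=> p; split=> [[f ->]|[u [v [r [hu hv ->]]]]].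
    rewrite -/(J _); apply: big_ind => // u _; apply: big_ind => // v huv.
    (* Both orientations of an edge give the same monomial. *)
    apply: JM; case/orP: huv => [|/Jarc]; first exact: Jarc.
    by rewrite mulrC.
  apply: edge_idealD; first apply: edge_idealD.
  (* [P] is the colon ideal of the edge ideal by [X], which contains the variables of [A]. *)
  + apply: (esc_ed_ideal (P := fun q => edge_ideal (L_edge a b c) (X * q))).
    * by rewrite mulr0; apply: edge_ideal0.
    * by move=> q q' hq hq'; rewrite mulrDr; apply: edge_idealD.
    * by move=> r' q hq; rewrite mulrCA; apply: edge_idealM.
    move=> i /(mem_nth yv); rewrite memX => hi; apply: edge_ideal_edge.
    by rewrite /L_edge /L_arc /=; case/orP: hi => ->; rewrite ?orbT.
  + apply: (esc_ed_ideal (P := fun q => edge_ideal (L_edge a b c) (Y * q))).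
    * by rewrite mulr0; apply: edge_ideal0.
    * by move=> q q' hq hq'; rewrite mulrDr; apply: edge_idealD.
    * by move=> r' q hq; rewrite mulrCA; apply: edge_idealM.
    move=> i /(mem_nth xv); rewrite memY => hi; apply: edge_ideal_edge.
    by rewrite /L_edge /L_arc /=; case/orP: hi => ->; rewrite ?orbT.
  by rewrite mulrC; apply: edge_idealM; apply: edge_ideal_edge.
(* The constant term is a ring morphism killing every variable, so minimality reduces to
   [gdiff_rmorph0]. *)
- have ev0 i : ('X_i : {mpoly k[a + b + c + 2]})@_0%MM = 0.
    by rewrite mcoeffX -mdeg_eq0 mdeg1.
  pose ev : {rmorphism {mpoly k[a + b + c + 2]} -> k} := mcoeff 0%MM.
  move=> i j; apply: (gdiff_rmorph0 (ev := ev)); rewrite /ev /= ?ev0 //;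
    move=> l _; exact: ev0.
by exists (@gmul _ (size sX) (size sY) tX tY X Y); apply: gdiff_dga.
Qed.
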